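(* Let $n\in\mathbb N$, let $\mathcal E=\mathbb C/\Gamma$, and let $\eta\in\mathcal E$ be a point of infinite order. For any $p\in\mathbb N$ there is an algebra homomorphism $\phi_p\colon Q_n(\mathcal E,\eta)\to B_{p,n}(\eta)$ that acts on the generators $f\in\Theta_{n,c}(\Gamma)=F_1$ of $Q_n(\mathcal E,\eta)$ by $$\phi_p(f)=\sum_{1\le\alpha\le p}\frac{f(u_\alpha)}{\prod_{i\ne\alpha}\theta(u_\alpha-u_i)}\,e_\alpha .$$
   Context: $\Gamma\subset\mathbb C$ is the lattice generated by $1$ and $\tau$, $\mathrm{Im}\,\tau>0$. $\theta(z)=\sum_{\alpha\in\mathbb Z}(-1)^\alpha e^{2\pi i(\alpha z+\frac{\alpha(\alpha-1)}2\tau)}$. $\eta$ has infinite order if $N\eta\notin\Gamma$ for all $N\in\mathbb N$ ($\eta$ is lifted to $\mathbb C$). $c\in\mathbb C$ is fixed; $\Theta_{n,c}(\Gamma)$ is the $n$-dimensional space of entire functions with $f(z+1)=f(z)$, $f(z+\tau)=(-1)^ne^{-2\pi i(nz-c)}f(z)$. Definition of $Q_n(\mathcal E,\eta)$: it is the graded associative algebra $\bigoplus_{\alpha\ge0}F_\alpha$, where $F_0=\mathbb C$ and $F_\alpha$ is the space of holomorphic symmetric functions $f(z_1,\dots,z_\alpha)$ with $f(z_1+1,z_2,\dots)=f$ and $f(z_1+\tau,z_2,\dots,z_\alpha)=(-1)^ne^{-2\pi i(nz_1-c-(\alpha-1)n\eta)}f(z_1,\dots,z_\alpha)$ (so $F_1=\Theta_{n,c}(\Gamma)$),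 with product, for $f\in F_\alpha$, $g\in F_\beta$, $$f*g(z_1,\dots,z_{\alpha+\beta})=\frac1{\alpha!\beta!}\sum_{\sigma\in S_{\alpha+\beta}}f(z_{\sigma_1},\dots,z_{\sigma_\alpha})g(z_{\sigma_{\alpha+1}}-2\alpha\eta,\dots,z_{\sigma_{\alpha+\beta}}-2\alpha\eta)\prod_{\substack{1\le i\le\alpha\\ \alpha+1\le j\le\alpha+\beta}}\frac{\theta(z_{\sigma_i}-z_{\sigma_j}-n\eta)}{\theta(z_{\sigma_i}-z_{\sigma_j})}.$$ Definition of $B_{p,n}(\eta)$: it is the $\mathbb Z^p$-graded algebra whose component of degree $(\alpha_1,\dots,\alpha_p)$ is $\{f(u_1,\dots,u_p)e_1^{\alpha_1}\cdots e_p^{\alpha_p}\}$, $f$ ranging over meromorphic functions of $p$ variables; it is generated by the meromorphic functions $f(u_1,\dots,u_p)$ (which commute with each other, with ordinary multiplication) and $e_1,\dots,e_p$, with defining relations $e_\alpha e_\beta=e_\beta e_\alpha$ and $$e_\alpha f(u_1,\dots,u_p)=f(u_1-2\eta,\dots,u_\alpha+(n-2)\eta,\dots,u_p-2\eta)\,e_\alpha$$ (the $\alpha$th argument is shifted by $(n-2)\eta$, all other arguments by $-2\eta$). *)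

(* Defs.v *)
From HB Require Import structures.
From mathcomp Require Import all_boot all_order all_algebra perm.
From mathcomp Require Import ring_quotient.
From mathcomp Require Import all_classical all_reals all_analysis.
From mathcomp Require Import complex ring.
From mathcomp Require mpoly.
(* The notations of mpoly clash with those of MathComp-Analysis. *)
From mathcomp Require Import (canonicals, coercions) mpoly.
Import numFieldNormedType.Exports.

Set Implicit Arguments.
Unset Strict Implicit.
Unset Printing Implicit Defensive.

Import Order.TTheory GRing.Theory Num.Theory.
Local Open Scope ring_scope.
Local Open Scope classical_set_scope.
Local Open Scope complex_scope.
Local Open Scope quotient_scope.

(* The complex numbers, as a numFieldType: numFieldNormedType gives them (and
   the row vectors over them) their topology, and differentiable then means
   complex differentiable. *)
Definition Cplx (R : realType) : numFieldType := R[i].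

Section Theta.
Context {R : realType}.
Notation C := (Cplx R).

Definition cexp (z : C) : C :=
  (expR (complex.Re z))%:C * (cos (complex.Im z) +i* sin (complex.Im z)).

Definition twopii : C := 2 * (pi : R)%:C * (0 +i* 1).

Definition lattice (tau : C) : set C :=
  [set z | exists a b : int, z = a%:~R + b%:~R * tau].

Definition theta_term (tau z : C) (a : int) : C :=
  (-1) ^ a * cexp (twopii * (a%:~R * z + (a * (a - 1))%:~R / 2 * tau)).

(* The sum over all integers is the sum over k >= 0 plus the sum over k < 0. *)
Definition theta (tau z : C) : C :=
  limn (series (fun k : nat => theta_term tau z k%:Z)) +
  limn (series (fun k : nat => theta_term tau z (- k.+1%:Z))).

Definition infinite_order (tau eta : C) : Prop :=
  forall N : nat, (0 < N)%N -> ~ lattice tau (N%:R * eta).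

Definition Theta_space (n : nat) (c tau : C) : set (C -> C) :=
  [set f : C -> C | [/\ forall z : C, differentiable f z,
               forall z, f (z + 1) = f z &
               forall z, f (z + tau) =
                 (-1) ^+ n * cexp (- twopii * (n%:R * z - c)) * f z]].

End Theta.

Section EllipticAlgebra.
Context {R : realType}.
Notation C := (Cplx R).
Variables (n : nat) (c tau eta : C).

(* Points of C^a are row vectors; the (quasi-)periodicity is imposed on the
   first variable, so there is no such condition when a = 0. *)
Definition Fspace (a : nat) : set ('rV[C]_a -> C) :=
  [set f | [/\ forall z, differentiable f z,
               forall (s : 'S_a) z, f (col_perm s z) = f z,
               forall (i : 'I_a) z, i = 0%N :> nat ->
                 f (z + delta_mx 0 i) = f z &
               forall (i : 'I_a) z, i = 0%N :> nat ->
                 f (z + tau *: delta_mx 0 i) =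
                 (-1) ^+ n *
                 cexp (- twopii * (n%:R * z 0 i - c - a.-1%:R * n%:R * eta)) *
                 f z]].

(* The right-hand side of the product formula, meaningful off the zeros of the
   denominators, i.e. on star_domain. *)
Definition star_formula (a b : nat) (f : 'rV[C]_a -> C) (g : 'rV[C]_b -> C)
    (z : 'rV[C]_(a + b)) : C :=
  (a`!%:R * b`!%:R)^-1 *
  \sum_(s : 'S_(a + b))
     f (\row_i z 0 (s (lshift b i))) *
     g (\row_j (z 0 (s (rshift a j)) - 2 * a%:R * eta)) *
     \prod_(i < a) \prod_(j < b)
        (theta tau (z 0 (s (lshift b i)) - z 0 (s (rshift a j)) - n%:R * eta) /
         theta tau (z 0 (s (lshift b i)) - z 0 (s (rshift a j)))).

Definition star_domain (m : nat) : set 'rV[C]_m :=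
  [set z | forall i j, i != j -> theta tau (z 0 i - z 0 j) != 0].

(* The apparent poles of the formula cancel and the product is its continuous
   extension: at a point of the dense open set star_domain the limit is the
   value of the formula. *)
Definition star (a b : nat) (f : 'rV[C]_a -> C) (g : 'rV[C]_b -> C)
    (z : 'rV[C]_(a + b)) : C :=
  lim (star_formula f g w @[w --> within (star_domain (m := a + b)) (nbhs z)]).

Definition gfam := forall a : nat, 'rV[C]_a -> C.

(* The direct sum of the spaces F_a. *)
Definition Qn : set gfam :=
  [set x | (forall a, Fspace (x a)) /\
           exists N : nat, forall a, (N <= a)%N -> x a = cst 0].

Definition glin (k : C) (x y : gfam) : gfam := fun a z => k * x a z + y a z.

Definition gone : gfam := fun a =>
  match a return 'rV[C]_a -> C with 0 => cst 1 | _.+1 => cst 0 end.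

Definition gmul (x y : gfam) : gfam := fun d z =>
  \sum_(a < d.+1) star (x a) (y (d - a)%N)
     (castmx (erefl 1%N, esym (subnKC (leq_ord a))) z).

(* A function of one variable, in degree 1. *)
Definition ggen (f : C -> C) : gfam := fun a =>
  match a return 'rV[C]_a -> C with 1 => fun z => f (z 0 0) | _ => cst 0 end.

Lemma ggen_Qn (f : C -> C) : Theta_space n c tau f -> Qn (ggen f).
Proof.
case=> df f1 ftau; split; last by exists 2%N => -[|[|a]].
have F0 a : Fspace (cst 0 : 'rV[C]_a -> C).
  by split=> // i z _; rewrite /= mulr0.
case=> [|[|a]] //; split => [z|s z|i z _|i z _] /=.
- exact: (differentiable_comp (differentiable_coord z 0 0)).
- by rewrite mxE; congr (f (z _ _)); exact: ord1.
- by rewrite !mxE ord1 f1.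
- by rewrite !mxE ord1 !eqxx mulr1 ftau mul0r mul0r subr0.
Qed.

(* phi is constrained on Qn only; Qn is stable under the product, so this says
   that phi restricts to a morphism of unital algebras from Qn to B. *)
Record Qn_morphism (B : algType C) (phi : gfam -> B) : Prop := QnMorphism {
  Qn_morphism_lin : forall k x y, Qn x -> Qn y ->
    phi (glin k x y) = k *: phi x + phi y;
  Qn_morphism1 : phi gone = 1;
  Qn_morphismM : forall x y, Qn x -> Qn y -> phi (gmul x y) = phi x * phi y
}.

End EllipticAlgebra.

Arguments gfam R : clear implicits.
Arguments glin {R} k x y _ _.
Arguments gone {R} _ _.
Arguments gmul {R} n tau eta x y _ _.
Arguments ggen {R} f _ _.

Section Meromorphic.
Context {R : realType} (p : nat).
Notation C := (Cplx R).
Notation V := 'rV[C]_p.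
Implicit Types (f g h : V -> C).

(* f represents a meromorphic function: near every point there are holomorphic
   g and h, h vanishing identically on no nonempty open set, such that
   f = g / h off the zeros of h.  Values on the zeros of h are arbitrary. *)
Definition meromorphic f : Prop := forall z : V, exists g h : V -> C,
  \forall w \near z, [/\ differentiable g w, differentiable h w,
    closure [set v | h v != 0] w & h w != 0 -> f w = g w / h w].

Definition generically_zero f : Prop := dense ([set z | f z = 0]^°).

Lemma near_shift (v z : V) (P : set V) :
  (\forall w \near z + v, P w) -> \forall w \near z, P (w + v).
Proof.
have cv := @cvgD _ _ _ (nbhs z) _ id (cst v) _ _ cvg_id (@cvg_cst _ v _ (nbhs z) _).
by move=> h; exact: (cv _ _ _ h).
Qed.

Lemma closure_neq0M g h (z : V) :
  (\forall w \near z, differentiable g w) ->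
  (\forall w \near z, closure [set v | g v != 0] w) ->
  (\forall w \near z, closure [set v | h v != 0] w) ->
  \forall w \near z, closure [set v | g v * h v != 0] w.
Proof.
move=> dg cg ch.
have := filterI (near_join dg) (filterI cg (near_join ch)).
move=> X; apply: (filterS _ (X _ _)) => w [dgw [cgw chw]] B Bw.
have [v [gv [[/= dgv chv] Bv]]] := cgw _ (filterI (filterI dgw chw) (nbhs_interior Bw)).
have gn0 : \forall y \near v, g y != 0.
  have cv : {for v, continuous g}.
    by apply: differentiable_continuous; exact: dgv.
  have : nbhs (g v) [set x | x != 0].
    apply: open_nbhs_nbhs; split => //.
    rewrite [X in open X](_ : _ = ~` [set 0]); last first.
      by apply/seteqP; split => x /eqP.
    apply: closed_openC; apply: accessible_closed_set1.
    by apply: hausdorff_accessible; exact: norm_hausdorff.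
  exact: cv.
have [y [hy [/= By gy]]] := chv _ (filterI Bv gn0).
by exists y; split => //; rewrite /= mulf_neq0.
Qed.

Lemma meromorphic_cst (k : C) : meromorphic (cst k).
Proof.
move=> z; exists (cst k), (cst 1); near=> w; split.
- exact: differentiable_cst.
- exact: differentiable_cst.
- by apply: subset_closure; rewrite /= oner_neq0.
- by rewrite /= divr1.
Unshelve. all: by end_near. Qed.

Lemma meromorphic_op (op : C -> C -> C) (num : C -> C -> C -> C -> C) f f' :
  (forall a b a' b', b != 0 -> b' != 0 ->
     op (a / b) (a' / b') = num a b a' b' / (b * b')) ->
  (forall (g h g' h' : V -> C) (w : V),
     differentiable g w -> differentiable h w ->
     differentiable g' w -> differentiable h' w ->
     differentiable (fun w => num (g w) (h w) (g' w) (h' w)) w) ->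
  meromorphic f -> meromorphic f' -> meromorphic (fun w => op (f w) (f' w)).
Proof.
move=> opE dnum mf mf' z; have [g [h H]] := mf z; have [g' [h' H']] := mf' z.
exists (fun w => num (g w) (h w) (g' w) (h' w)), (h * h').
have c : \forall w \near z, closure [set v | h v * h' v != 0] w.
  by apply: closure_neq0M; [move: H|move: H|move: H'];
    apply: filterS => w [].
apply: filterS (filterI c (filterI H H')) => w [cw [[dg dh _ e] [dg' dh' _ e']]].
split; [exact: dnum|exact: differentiableM|exact: cw|].
rewrite mulf_eq0 negb_or => /andP[h0 h0'].
by rewrite (e h0) (e' h0') (opE _ _ _ _ h0 h0').
Qed.

Lemma meromorphicB f f' : meromorphic f -> meromorphic f' -> meromorphic (f - f').
Proof.
apply: (@meromorphic_op (fun x y => x - y) (fun a b a' b' => a * b' - a' * b)).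
  by move=> a b a' b' b0 b0'; field; rewrite b0 b0'.
by move=> g h g' h' w *; apply: differentiableB; exact: differentiableM.
Qed.

Lemma meromorphicM f f' : meromorphic f -> meromorphic f' -> meromorphic (f * f').
Proof.
apply: (@meromorphic_op (fun x y => x * y) (fun a _ a' _ => a * a')).
  by move=> a b a' b' b0 b0'; field; rewrite b0 b0'.
by move=> g h g' h' w *; exact: differentiableM.
Qed.

Lemma meromorphic_shift (v : V) f :
  meromorphic f -> meromorphic (fun w => f (w + v)).
Proof.
move=> mf z; have [g [h H]] := mf (z + v).
exists (fun w => g (w + v)), (fun w => h (w + v)).
have dsh k w : differentiable k (w + v) ->
    differentiable (fun w : V => k (w + v) : C) w.
  move=> dk; have ds : differentiable ((id : V -> V) + cst v) w.
    apply: differentiableD; last exact: differentiable_cst.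
    by apply: (@linear_differentiable _ _ _ idfun) => ? //.
  exact: (@differentiable_comp _ _ _ _ ((id : V -> V) + cst v) k w ds dk).
move/near_shift: H; apply: filterS => w [dg dh ch e].
split; [exact: dsh|exact: dsh| |exact: e].
move=> B; rewrite -[w](addrK v) => /near_shift Bw.
have [y [hy By]] := ch _ Bw; exists (y - v).
by split => //=; rewrite subrK.
Qed.

Definition meromorphic_pred : {pred (V -> C)} := fun f => `[< meromorphic f >].

Lemma meromorphic_subring_closed : subring_closed meromorphic_pred.
Proof.
split=> [|f g /asboolP mf /asboolP mg|f g /asboolP mf /asboolP mg]; apply/asboolP.
- exact: meromorphic_cst.
- exact: meromorphicB.
- exact: meromorphicM.
Qed.

HB.instance Definition _ :=
  GRing.isSubringClosed.Build (V -> C) meromorphic_pred meromorphic_subring_closed.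

Record merofun := MeroFun {
  merofun_val :> V -> C;
  _ : merofun_val \in meromorphic_pred
}.

HB.instance Definition _ := [isSub for merofun_val].
HB.instance Definition _ := [Choice of merofun by <:].
HB.instance Definition _ := [SubChoice_isSubComNzRing of merofun by <:].

Definition meronull : {pred merofun} := fun x : merofun => `[< generically_zero x >].

Lemma meronull_closed : idealr_closed meronull.
Proof.
split.
- apply/asboolP; rewrite /generically_zero.
  rewrite (_ : [set z | _] = setT) ?interiorT; last exact/seteqP.
  by move=> A A0 _; rewrite setIT.
- apply/asboolP => d.
  have [z [_ /interior_subset /= /eqP]] : [set: V] `&` [set z : V | ((1 : merofun) : V -> C) z = 0]^° !=set0.
    by apply: d; [exists 0|exact: openT].
  by rewrite oner_eq0.
- move=> a u v /asboolP du /asboolP dv; apply/asboolP.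
  have d := denseI (open_interior _) du dv.
  move=> A A0 oA; have [z [Az [uz vz]]] := d A A0 oA; exists z; split=> //.
  apply: filterS (filterI uz vz) => w [/= uw vw].
  by rewrite [LHS](_ : _ = (a : V -> C) w * (u : V -> C) w + (v : V -> C) w)// uw vw mulr0 addr0.
Qed.

HB.instance Definition _ := isIdealr.Build merofun meronull meronull_closed.

(* The ring of meromorphic functions on C^p: representatives are identified
   when they agree on a dense open set. *)
Definition mero : comNzRingType := {ideal_quot meronull}.

(* m is the meromorphic function given by the formula f. *)
Definition mero_represented (m : mero) (f : V -> C) : Prop :=
  exists2 g : merofun, (g : V -> C) = f & m = \pi_mero g.

Lemma mero_eqP (f g : merofun) :
  reflect (dense ([set z | (f : V -> C) z = (g : V -> C) z]^°)) (\pi_mero f == \pi_mero g).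
Proof.
rewrite -Quotient.idealrBE.
have e : [set z : V | ((f - g : merofun) : V -> C) z = 0] =
         [set z | (f : V -> C) z = (g : V -> C) z].
  apply/seteqP; split => z /= h.
    by apply/eqP; rewrite -subr_eq0; apply/eqP.
  by rewrite [LHS](_ : _ = (f : V -> C) z - (g : V -> C) z)// h subrr.
by apply: (iffP idP) => [/asboolP|h]; [|apply/asboolP]; rewrite /generically_zero e.
Qed.

Definition merofun_cst (k : C) : merofun :=
  MeroFun (introT (asboolP _) (meromorphic_cst k)).

Definition mero_cst (k : C) : mero := \pi_mero (merofun_cst k).

Lemma mero_cst_is_zmod_morphism : zmod_morphism mero_cst.
Proof.
by move=> a b; rewrite /mero_cst -[RHS]raddfB; congr (\pi_mero _); apply/val_inj.
Qed.

Lemma mero_cst_is_monoid_morphism : monoid_morphism mero_cst.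
Proof.
split=> [|a b]; rewrite /mero_cst.
  by rewrite -[RHS](rmorph1 \pi_mero); congr (\pi_mero _); apply/val_inj.
by rewrite -[RHS]rmorphM; congr (\pi_mero _); apply/val_inj.
Qed.

HB.instance Definition _ :=
  GRing.isZmodMorphism.Build C mero mero_cst mero_cst_is_zmod_morphism.
HB.instance Definition _ :=
  GRing.isMonoidMorphism.Build C mero mero_cst mero_cst_is_monoid_morphism.

Definition merofun_shift (v : V) (f : merofun) : merofun :=
  MeroFun (introT (asboolP _) (meromorphic_shift v (elimT (asboolP _) (valP f)))).

(* The ring automorphism f(u) |-> f(u + v). *)
Definition mero_shift (v : V) (m : mero) : mero :=
  \pi_mero (merofun_shift v (repr m)).

Lemma mero_shift_pi v (f : merofun) :
  mero_shift v (\pi_mero f) = \pi_mero (merofun_shift v f).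
Proof.
apply/eqP/mero_eqP => O [x Ox] oO.
have /eqP/mero_eqP d : \pi_mero (repr (\pi_mero f)) = \pi_mero f by rewrite reprK.
have oO' : open [set z | O (z - v)].
  rewrite openE => z Oz.
  have : \forall w \near z - v, O w by apply: open_nbhs_nbhs.
  exact: near_shift.
have [z [Oz Iz]] := d _ (ex_intro _ (x + v) (eq_ind_r O Ox (addrK v x))) oO'.
exists (z - v); split => //.
have h := @near_shift v (z - v)
  [set w | (repr (\pi_mero f) : V -> C) w = (f : V -> C) w].
by rewrite subrK in h; exact: h Iz.
Qed.

Lemma mero_shift_is_zmod_morphism v : zmod_morphism (mero_shift v).
Proof.
move=> a b; rewrite -[a]reprK -[b]reprK -raddfB !mero_shift_pi -raddfB.
by congr (\pi_mero _); apply/val_inj.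
Qed.

Lemma mero_shift_is_monoid_morphism v : monoid_morphism (mero_shift v).
Proof.
split=> [|a b].
  rewrite -(rmorph1 \pi_mero) mero_shift_pi.
  by congr (\pi_mero _); apply/val_inj.
rewrite -[a]reprK -[b]reprK -rmorphM !mero_shift_pi -rmorphM.
by congr (\pi_mero _); apply/val_inj.
Qed.

HB.instance Definition _ v :=
  GRing.isZmodMorphism.Build mero mero (mero_shift v) (mero_shift_is_zmod_morphism v).
HB.instance Definition _ v :=
  GRing.isMonoidMorphism.Build mero mero (mero_shift v) (mero_shift_is_monoid_morphism v).

Lemma mero_shift0 m : mero_shift 0 m = m.
Proof.
rewrite -[m]reprK mero_shift_pi; congr (\pi_mero _); apply/val_inj/funext => z /=.
by rewrite addr0.
Qed.

Lemma mero_shiftD v w m : mero_shift (v + w) m = mero_shift v (mero_shift w m).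
Proof.
rewrite -[m]reprK !mero_shift_pi; congr (\pi_mero _); apply/val_inj/funext => z /=.
by rewrite addrA reprK.
Qed.

Lemma mero_shift_cst v k : mero_shift v (mero_cst k) = mero_cst k.
Proof. by rewrite /mero_cst mero_shift_pi; congr (\pi_mero _); apply/val_inj. Qed.

End Meromorphic.

Arguments mero R p : clear implicits.

Section SkewPolynomials.
Context (M : comNzRingType) (p : nat).
Context (s : mpoly.multinom p -> {rmorphism M -> M}).
Hypothesis s0 : forall m, s mpoly.mnm0 m = m.
Hypothesis sD : forall a b m, s (mpoly.mnm_add a b) m = s a (s b m).
Notation P := (mpoly.mpoly p M).
Notation X := (mpoly.mpolyX M).
Notation "x @_ a" := (mpoly.mcoeff a x) (at level 3, a at level 2).
Implicit Types (x y z : P) (a b : mpoly.multinom p).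

(* The product on M[e_1, ..., e_p] for which e^a m = s_a(m) e^a. *)
Definition skew_mul x y : P :=
  \sum_(a <- mpoly.msupp x) x@_a *: (X a * mpoly.map_mpoly (s a) y).

Lemma skew_mulw (d : seq (mpoly.multinom p)) x y :
  uniq d -> {subset mpoly.msupp x <= d} ->
  skew_mul x y = \sum_(a <- d) x@_a *: (X a * mpoly.map_mpoly (s a) y).
Proof.
move=> ud sd; rewrite [RHS](bigID (mem (mpoly.msupp x))) /= [X in _ + X]big1.
  rewrite addr0 -big_filter; apply: perm_big; apply: uniq_perm.
  - exact: mpoly.msupp_uniq.
  - exact: filter_uniq.
  - move=> a; rewrite mem_filter /=; case: (boolP (a \in _)) => // /sd -> //.
by move=> a /mpoly.memN_msupp_eq0 ->; rewrite scale0r.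
Qed.

Lemma skew_mulDl x y z : skew_mul (x + y) z = skew_mul x z + skew_mul y z.
Proof.
pose d := undup (mpoly.msupp x ++ mpoly.msupp y ++ mpoly.msupp (x + y)).
rewrite !(@skew_mulw d) ?undup_uniq//; first last.
- by move=> a ha; rewrite mem_undup !mem_cat ha !orbT.
- by move=> a ha; rewrite mem_undup !mem_cat ha.
- by move=> a ha; rewrite mem_undup !mem_cat ha !orbT.
by rewrite -big_split; apply: eq_bigr => a _; rewrite raddfD scalerDl.
Qed.

Lemma skew_mulDr x y z : skew_mul x (y + z) = skew_mul x y + skew_mul x z.
Proof.
rewrite -big_split; apply: eq_bigr => a _.
by rewrite raddfD mulrDr scalerDr.
Qed.

Lemma skew_mul0l y : skew_mul 0 y = 0.
Proof. by rewrite /skew_mul mpoly.msupp0 big_nil. Qed.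

Lemma skew_mul0r x : skew_mul x 0 = 0.
Proof. by rewrite /skew_mul big1// => a _; rewrite raddf0 mulr0 scaler0. Qed.

Lemma skew_mul_mono k a y :
  skew_mul (k *: X a) y = k *: (X a * mpoly.map_mpoly (s a) y).
Proof.
rewrite (@skew_mulw [:: a])//.
  by rewrite big_seq1 mpoly.mcoeffZ mpoly.mcoeffX eqxx mulr1.
by move=> b /mpoly.msuppZ_le; rewrite mpoly.msuppX.
Qed.

Lemma skew_mulZl k x y : skew_mul (k *: x) y = k *: skew_mul x y.
Proof.
elim/mpoly.mpolyind: x => [|c a x _ _ IH]; first by rewrite scaler0 skew_mul0l scaler0.
by rewrite scalerDr !skew_mulDl scalerDr IH scalerA !skew_mul_mono scalerA.
Qed.

Lemma map_mpolyD a b z :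
  mpoly.map_mpoly (s (mpoly.mnm_add a b)) z =
  mpoly.map_mpoly (s a) (mpoly.map_mpoly (s b) z).
Proof. by apply/mpoly.mpolyP => c; rewrite !mpoly.mcoeff_map_mpoly; exact: sD. Qed.

Lemma skew_mulA : associative skew_mul.
Proof.
have mono1 c a d b z : skew_mul (c *: X a) (skew_mul (d *: X b) z) =
    skew_mul (skew_mul (c *: X a) (d *: X b)) z.
  rewrite !skew_mul_mono !mpoly.map_mpolyZ rmorphM /= !mpoly.map_mpolyX.
  rewrite -!scalerAr !scalerA -mpoly.mpolyXD skew_mul_mono map_mpolyD.
  by rewrite mpoly.mpolyXD mulrA.
have mono c a y z : skew_mul (c *: X a) (skew_mul y z) =
    skew_mul (skew_mul (c *: X a) y) z.
  elim/mpoly.mpolyind: y => [|d b y _ _ IH]; first by rewrite !(skew_mul0l, skew_mul0r).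
  by rewrite skew_mulDl [LHS]skew_mulDr skew_mulDr [RHS]skew_mulDl IH mono1.
move=> x y z; elim/mpoly.mpolyind: x => [|c a x _ _ IH]; first by rewrite !skew_mul0l.
by rewrite [LHS]skew_mulDl skew_mulDl [RHS]skew_mulDl IH mono.
Qed.

Lemma skew_mul1l : left_id (1 : P) skew_mul.
Proof.
move=> x; rewrite -[1](_ : 1 *: X mpoly.mnm0 = 1) ?scale1r ?mpoly.mpolyX0//.
rewrite -mpoly.mpolyX0 -[X _]scale1r skew_mul_mono scale1r mpoly.mpolyX0 mul1r.
by apply/mpoly.mpolyP => c; rewrite mpoly.mcoeff_map_mpoly; exact: s0.
Qed.

Lemma skew_mul1r : right_id (1 : P) skew_mul.
Proof.
move=> x; rewrite [RHS]mpoly.mpolyE /skew_mul; apply: eq_bigr => a _.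
by rewrite rmorph1 mulr1.
Qed.

End SkewPolynomials.

(* e_a f(u) = f(u + Bgen_shift a) e_a, hence e^m f(u) = f(u + Bmon_shift m) e^m;
   see Bgen_fun. *)
Definition Bgen_shift (R : realType) (eta : Cplx R) (n p : nat) (a : 'I_p) :
  'rV[Cplx R]_p := \row_j ((if j == a then n%:R - 2 else - 2) * eta).

Definition Bmon_shift (R : realType) (eta : Cplx R) (n p : nat)
    (m : mpoly.multinom p) : 'rV[Cplx R]_p :=
  \sum_(a < p) Bgen_shift eta n a *+ m a.

(* The free left module over the meromorphic functions on the monomials e^m,
   m in N^p; n and eta only enter through the product below. *)
Definition Balg (R : realType) (eta : Cplx R) (n p : nat) : Type :=
  mpoly.mpoly p (mero R p).

Section BAlgebra.
Context {R : realType} (eta : Cplx R) (n p : nat).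
Notation M := (mero R p).
Notation B := (Balg eta n p).

HB.instance Definition _ := GRing.Zmodule.copy B (mpoly.mpoly p M).

Definition Bmul (x y : B) : B :=
  skew_mul (fun m => mero_shift (Bmon_shift eta n m)) x y.

Lemma Bmon_shift0 (f : M) : mero_shift (Bmon_shift eta n mpoly.mnm0) f = f.
Proof.
rewrite (_ : Bmon_shift _ _ _ = 0) ?mero_shift0// /Bmon_shift big1// => a _.
by rewrite mpoly.mnm0E.
Qed.

Lemma Bmon_shiftD a b (f : M) :
  mero_shift (Bmon_shift eta n (mpoly.mnm_add a b)) f =
  mero_shift (Bmon_shift eta n a) (mero_shift (Bmon_shift eta n b) f).
Proof.
rewrite -mero_shiftD /Bmon_shift -big_split; congr (mero_shift _ _).
by apply: eq_bigr => i _; rewrite mpoly.mnmDE mulrnDr.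
Qed.

Lemma BmulA : associative Bmul.
Proof. exact: skew_mulA Bmon_shiftD. Qed.
Lemma Bmul1l : left_id (1 : mpoly.mpoly p M) Bmul.
Proof. exact: skew_mul1l Bmon_shift0. Qed.
Lemma Bmul1r : right_id (1 : mpoly.mpoly p M) Bmul.
Proof. exact: skew_mul1r. Qed.
Lemma BmulDl : left_distributive Bmul +%R.
Proof. by move=> x y z; exact: skew_mulDl. Qed.
Lemma BmulDr : right_distributive Bmul +%R.
Proof. by move=> x y z; exact: skew_mulDr. Qed.

HB.instance Definition _ := GRing.Zmodule_isNzRing.Build B
  BmulA Bmul1l Bmul1r BmulDl BmulDr (oner_neq0 (mpoly.mpoly p M)).

Definition Bscale (k : Cplx R) (x : B) : B :=
  mero_cst p k *: (x : mpoly.mpoly p M).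

Lemma BscaleA a b x : Bscale a (Bscale b x) = Bscale (a * b) x.
Proof. by rewrite /Bscale scalerA rmorphM. Qed.
Lemma Bscale1 : left_id 1 Bscale.
Proof. by move=> x; rewrite /Bscale rmorph1 scale1r. Qed.
Lemma BscaleDr : right_distributive Bscale +%R.
Proof. by move=> a x y; exact: scalerDr. Qed.
Lemma BscaleDl x : {morph Bscale^~ x : a b / a + b}.
Proof. by move=> a b; rewrite /Bscale rmorphD scalerDl. Qed.

HB.instance Definition _ := GRing.Zmodule_isLmodule.Build (Cplx R) B
  BscaleA Bscale1 BscaleDr BscaleDl.

Lemma BscaleAl k (x y : B) : k *: (x * y) = k *: x * y.
Proof. by symmetry; exact: skew_mulZl. Qed.

HB.instance Definition _ := GRing.Lmodule_isLalgebra.Build (Cplx R) B BscaleAl.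

Lemma BscaleAr k (x y : B) : k *: (x * y) = x * (k *: y).
Proof.
rewrite [LHS]scaler_sumr; apply: eq_bigr => a _ /=.
rewrite mpoly.map_mpolyZ -scalerAr !scalerA /= mero_shift_cst.
by rewrite [mpoly.mcoeff a x * _]mulrC -[RHS](@scalerA M (mpoly.mpoly p M)).
Qed.

HB.instance Definition _ := GRing.Lalgebra_isAlgebra.Build (Cplx R) B BscaleAr.

Definition Bfun (f : M) : B := mpoly.mpolyC p f.

Definition Bgen (a : 'I_p) : B := mpoly.mpolyX M (mpoly.mnm1 a).

Lemma Bfun_mul (f : M) (x : mpoly.mpoly p M) : Bfun f * (x : B) = f *: x.
Proof.
rewrite /Bfun -[mpoly.mpolyC p f]mulr1 mpoly.mul_mpolyC -mpoly.mpolyX0.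
rewrite [LHS]skew_mul_mono mpoly.mpolyX0 mul1r; congr (GRing.scale f _).
by apply/mpoly.mpolyP => c; rewrite mpoly.mcoeff_map_mpoly; exact: Bmon_shift0.
Qed.

Lemma BfunM (f g : M) : Bfun f * Bfun g = Bfun (f * g).
Proof. by rewrite Bfun_mul -mpoly.mul_mpolyC -rmorphM. Qed.

Lemma BgenC (a b : 'I_p) : Bgen a * Bgen b = Bgen b * Bgen a.
Proof.
have e c d : Bgen c * Bgen d = mpoly.mpolyX M (mpoly.mnm_add (mpoly.mnm1 c) (mpoly.mnm1 d)).
  rewrite /Bgen -[mpoly.mpolyX M (mpoly.mnm1 c)]scale1r [LHS]skew_mul_mono.
  by rewrite mpoly.map_mpolyX scale1r mpoly.mpolyXD.
by rewrite !e mpoly.mpolyXD mulrC -mpoly.mpolyXD.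
Qed.

Lemma Bgen_fun (a : 'I_p) (f : M) :
  Bgen a * Bfun f = Bfun (mero_shift (Bgen_shift eta n a) f) * Bgen a.
Proof.
rewrite Bfun_mul /Bgen -[mpoly.mpolyX M (mpoly.mnm1 a)]scale1r [LHS]skew_mul_mono.
rewrite !scale1r mpoly.map_mpolyC mulrC mpoly.mul_mpolyC /=.
congr (mero_shift _ _ *: _); rewrite /Bmon_shift (bigD1 a)//= big1 ?addr0.
  by rewrite mpoly.mnm1E eqxx.
by move=> b ba; rewrite mpoly.mnm1E eq_sym (negPf ba).
Qed.

End BAlgebra.

(* Main.v *)
Require Import Defs.
From mathcomp Require Import all_boot all_order all_algebra perm.
From mathcomp Require Import all_classical all_reals all_analysis complex.
From mathcomp Require mpoly.
From mathcomp Require Import (canonicals, coercions) mpoly.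
From mathcomp Require Import ring lra zify.
Import numFieldNormedType.Exports.
Set Implicit Arguments.
Unset Strict Implicit.
Unset Printing Implicit Defensive.
Import Order.TTheory GRing.Theory Num.Theory.
Local Open Scope ring_scope.

(** Why the homomorphism exists.

    On a product of generators its value is forced: each e_i that is moved to
    the right shifts u, and the coefficient of e^m is the star product of the
    generators evaluated at the points u_i + k n eta, one for each box (i, k)
    with k < m_i, times a factor that depends on m and u only. Call this list
    of points Z_m(u). So set, for every x in F_d,

      phi(x) = \sum_(|m| = d) x(Z_m(u)) K_m(u) e^m,

      K_m(u) = theta(- n eta)^d /
        \prod_(i, j) \prod_(k < m_i) theta(u_i - u_j + (k - m_j) n eta).

    Multiplicativity is then an identity between functions of u. The sum over
    permutations in x * y is a sum over the sets S of boxes whose points are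
    given to x (star_formula_subsets). If S contains the box (i, k + 1) but not
    (i, k), then a factor theta(0) = 0 kills the term; so S consists of the
    bottom boxes of the columns and is an exponent m' <= m (sum_down_closed).
    For such S the product of theta quotients telescopes along columns and
    turns K_m(u) into K_m'(u) K_(m - m')(u + shift), where shift is the
    translation by which e^m' acts (kernel_cocycle), while the points outside S
    are those of m - m' translated by the same shift (shift_points). This is
    the formula for the coefficient of a product in the skew polynomial
    algebra (mcoeff_skew_mul).

    The star product is a limit, equal to its defining formula where no
    difference of two coordinates is a zero of theta. For the points Z_m(u) the
    differences are u_i - u_j + r n eta, and they are not in the lattice for u
    in a dense open set, the case i = j being the infinite order of eta. As a
    meromorphic function is determined by its values on a dense open set, the
    coefficients of phi are defined as germs (germ), and only generic u matter.

    This uses that theta vanishes only on the lattice (theta_zero_lattice),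
    which is read off Jacobi's triple product. The product is obtained from its
    finite form, a case of the q-binomial theorem (finite_triple_product), by
    dominated convergence for series (tannery). The same dominated convergence,
    applied to difference quotients, differentiates power series term by term
    and so shows that theta is holomorphic (differentiable_theta). *)

(** * Permutations counted by the image of a set *)

Section ShuffleSum.
Variable T : finType.
Implicit Types A B L S : {set T}.



(** Match the enumeration of A followed by that of its complement with the
    corresponding enumeration for B. *)
Lemma exists_perm_imset A B : #|A| = #|B| -> exists s : {perm T}, s @: A = B.
Proof.
move=> cAB.
pose eA := enum A ++ enum (~: A); pose eB := enum B ++ enum (~: B).
have uniq_e (S : {set T}) : uniq (enum S ++ enum (~: S)).
  rewrite cat_uniq !enum_uniq andbT /=; apply/hasPn => x.
  by rewrite !mem_enum inE.
have mem_e (S : {set T}) x : x \in enum S ++ enum (~: S).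
  by rewrite mem_cat !mem_enum inE orbN.
have sAB : size eA = size eB.
  by rewrite !size_cat -!cardE cAB; congr (_ + _)%N; have := cardsC A;
    have := cardsC B; lia.
pose f x := nth x eB (index x eA).
have iE x : (index x eA < size eB)%N by rewrite -sAB index_mem mem_e.
have fE x y : f x = nth y eB (index x eA) by apply: set_nth_default.
have f_inj : injective f.
  move=> x y; rewrite (fE y x) /f => /eqP; rewrite nth_uniq ?uniq_e//.
  by move=> /eqP/(congr1 (nth x eA)); rewrite !nth_index ?mem_e.
exists (perm f_inj); apply/eqP; rewrite eqEcard card_imset ?cAB ?leqnn ?andbT;
  last exact: perm_inj.
apply/fintype.subsetP => _ /imsetP[x xA ->]; rewrite permE /f /eB nth_cat.
have xB : (index x eA < size (enum B))%N.
  by rewrite -cardE -cAB cardE /eA index_cat mem_enum xA index_mem mem_enum.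
by rewrite xB -mem_enum mem_nth.
Qed.

(** Composition with a permutation that moves one set onto another shows that
    the count is the same for all sets of a given size; the total over these
    binomially many sets is the order of the symmetric group. *)
Lemma card_perm_imset L S : #|L| = #|S| ->
  #|[set s : {perm T} | s @: L == S]| = ((#|L|)`! * (#|~: L|)`!)%N.
Proof.
pose N S := #|[set s : {perm T} | s @: L == S]|.
have NE S1 S2 : #|S1| = #|S2| -> (N S1 <= N S2)%N.
  move=> /exists_perm_imset[r rS].
  rewrite /N -(card_imset _ (mulIg r)); apply: subset_leq_card.
  apply/fintype.subsetP => _ /imsetP[s + ->]; rewrite !inE => /eqP sS.
  rewrite -rS -sS; apply/eqP; rewrite -imset_comp; apply: eq_imset => x /=.
  by rewrite permM.
move=> LS; rewrite -/(N S).
have : (#|{perm T}| = 'C(#|T|, #|L|) * N S)%N.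
  rewrite -[LHS]cardsT -[LHS]sum1_card.
  rewrite (partition_big (fun s : {perm T} => s @: L) (fun S => #|S| == #|L|))
    /=; last first.
    by move=> s _; rewrite card_imset//; exact: perm_inj.
  transitivity (\sum_(S' : {set T} | #|S'| == #|L|) N S).
    apply: eq_bigr => S' /eqP S'L; rewrite sum1_card.
    transitivity (N S'); first by rewrite /N; apply: eq_card => s;
      rewrite unfold_in /= !inE.
    by apply/eqP; rewrite eqn_leq !NE// S'L.
  by rewrite sum_nat_const -card_draws; congr (_ * _)%N;
    apply: eq_card => s; rewrite !inE.
have -> : #|{perm T}| = (#|T|)`!.
  rewrite -cardsT -(card_perm [set: T]) -cardsE; apply: eq_card => s.
  by rewrite !inE; apply/esym/fintype.subsetP => x _; rewrite inE.
have LT : (#|L| <= #|T|)%N := max_card _.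
have -> : #|~: L| = (#|T| - #|L|)%N by rewrite -(cardsC L) addKn.
rewrite -(bin_fact LT) => /eqP; rewrite eqn_pmul2l ?bin_gt0// => /eqP ->.
by [].
Qed.

Lemma sum_perm_imset (V : nmodType) L (G : {set T} -> V) :
  \sum_(s : {perm T}) G (s @: L) =
  \sum_(S : {set T} | #|S| == #|L|) G S *+ ((#|L|)`! * (#|~: L|)`!).
Proof.
rewrite (partition_big (fun s : {perm T} => s @: L) (fun S => #|S| == #|L|))
  /=; last first.
  by move=> s _; rewrite card_imset//; exact: perm_inj.
apply: eq_bigr => S /eqP SL; rewrite -(card_perm_imset (esym SL)) -sum1_card -sumrMnr.
by apply: eq_big => [s|s /eqP ->]; rewrite ?inE ?mulr1n.
Qed.
End ShuffleSum.

(** * Exponents as columns of boxes *)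

Section Boxes.
Variable p : nat.
Notation multinom := (mpoly.multinom p).
Notation mdeg := mpoly.mdeg.
Notation box := ('I_p * nat)%type.
Implicit Types (m : multinom) (i : 'I_p) (k : nat) (x y : box).

(** The monomial e^m is pictured as p columns, the i-th of height m i. *)
Definition boxes m : seq box := [seq (i, k) | i <- enum 'I_p, k <- iota 0 (m i)].

Lemma mem_boxes m x : (x \in boxes m) = (x.2 < m x.1)%N.
Proof.
case: x => i k /=; apply/allpairsPdep/idP => [[j [l [_ + [-> ->]]]]|km].
  by rewrite mem_iota.
by exists i, k; rewrite mem_enum mem_iota.
Qed.

Lemma uniq_boxes m : uniq (boxes m).
Proof.
apply: allpairs_uniq_dep => [||[i k] [j l] _ _ /= [-> ->]]//; first exact: enum_uniq.
by move=> i _; exact: iota_uniq.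
Qed.

Lemma size_boxes m : size (boxes m) = mdeg m.
Proof.
rewrite size_allpairs_dep mpoly.mdegE sumnE big_map big_enum /=.
by apply: eq_bigr => i _; rewrite size_iota.
Qed.

Lemma big_boxes (V : Type) (idx : V) (op : Monoid.com_law idx) m (F : box -> V) :
  \big[op/idx]_(x <- boxes m) F x = \big[op/idx]_(i < p)
    \big[op/idx]_(k < m i) F (i, val k).
Proof.
rewrite big_allpairs_dep big_enum /=; apply: eq_bigr => i _.
by rewrite -[m i]subn0 -/(index_iota 0 _) big_mkord subn0.
Qed.

Section Labels.
Variable m : multinom.
Notation d := (mdeg m).

(** The coordinates of a point of C^(mdeg m) are indexed
    by positions, whereas the combinatorics is that of the boxes. *)
Definition label (t : 'I_d) : box :=
  tnth (Tuple (introT eqP (size_boxes m))) t.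

Lemma label_inj : injective label.
Proof. by apply/tuple_uniqP; exact: uniq_boxes. Qed.

Lemma label_mem t : ((label t).2 < m (label t).1)%N.
Proof. by rewrite -mem_boxes; exact: mem_tnth. Qed.

Lemma labelP x : (x.2 < m x.1)%N -> exists t, label t = x.
Proof.
rewrite -mem_boxes => xm.
have /tnthP[t ->] : x \in Tuple (introT eqP (size_boxes m)) by [].
by exists t.
Qed.

Definition lower m' : {set 'I_d} := [set t | (label t).2 < m' (label t).1]%N.

Definition le_multinom m' := forall i, (m' i <= m i)%N.

Lemma perm_lower m' : le_multinom m' ->
  perm_eq [seq label t | t <- enum (lower m')] (boxes m').
Proof.
move=> m'm; apply: uniq_perm; [|exact: uniq_boxes|].
  by rewrite map_inj_uniq ?enum_uniq//; exact: label_inj.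
move=> x; rewrite mem_boxes; apply/mapP/idP => [[t + ->]|xm'].
  by rewrite mem_enum inE.
have [|t tx] := @labelP x; first exact: leq_trans xm' (m'm _).
by exists t => //; rewrite mem_enum inE tx.
Qed.

Lemma perm_upper m' : le_multinom m' ->
  perm_eq [seq label t | t <- enum (~: lower m')]
          [seq (x.1, m' x.1 + x.2)%N | x <- boxes (mpoly.mnm_sub m m')].
Proof.
move=> m'm; apply: uniq_perm.
- by rewrite map_inj_uniq ?enum_uniq//; exact: label_inj.
- rewrite map_inj_in_uniq ?uniq_boxes// => -[i k] [j l] _ _ /= [-> /addnI ->] //.
- move=> x; apply/mapP/mapP => [[t + ->]|[y + ->]].
    rewrite mem_enum !inE -leqNgt => ml;
      exists ((label t).1, (label t).2 - m' (label t).1)%N => /=.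
      by rewrite mem_boxes /= mpoly.mnmBE ltn_sub2r ?label_mem//;
        exact: leq_ltn_trans ml (label_mem t).
    by rewrite subnKC//; case: (label t).
  rewrite mem_boxes mpoly.mnmBE => ym.
  have [|t ty] := @labelP (y.1, m' y.1 + y.2)%N; first by rewrite /= -ltn_subRL.
  by exists t => //; rewrite mem_enum !inE ty /= -leqNgt leq_addr.
Qed.

Lemma card_lower m' : le_multinom m' -> #|lower m'| = mdeg m'.
Proof.
by move=> m'm; rewrite cardE -(size_map label) (perm_size (perm_lower m'm)) size_boxes.
Qed.

(** Stated with single steps down, as these are what the zero of theta at the
    origin detects. *)
Definition down_closed (S : {set 'I_d}) : Prop := forall t t',
  t \in S -> (label t).1 = (label t').1 -> (label t).2 = (label t').2.+1 -> t' \in S.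

(** The heights of the columns of S, measured up to the first missing box;
    for down-closed S this describes S completely. *)
Definition profile (S : {set 'I_d}) : multinom :=
  mpoly.Multinom [tuple find (fun k => (i, k) \notin [seq label t | t <- enum S])
                    (iota 0 (m i)) | i < p].

Lemma profileE S i : profile S i =
  find (fun k => (i, k) \notin [seq label t | t <- enum S]) (iota 0 (m i)).
Proof. by rewrite mpoly.multinomE tnth_mktuple. Qed.

Lemma profile_le S : le_multinom (profile S).
Proof. by move=> i; rewrite profileE (leq_trans (find_size _ _))// size_iota. Qed.

Lemma mem_label (S : {set 'I_d}) t : (label t \in
  [seq label t | t <- enum S]) = (t \in S).
Proof. by rewrite mem_map ?mem_enum//; exact: label_inj. Qed.

(** Above the first missing box of a column there can be no box, since closure
    downwards would propagate it to the missing place. *)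
Lemma lower_profile S : down_closed S -> lower (profile S) = S.
Proof.
move=> cS; apply/setP => t; rewrite inE profileE -mem_label.
case E : (label t) => [i k] /=; have := label_mem t; rewrite E /= => km.
set P := (fun k => (i, k) \notin _).
apply/idP/idP => [kf|kS].
  have /negbT := before_find 0%N kf; rewrite nth_iota ?add0n /P ?negbK//.
rewrite ltnNge; apply/negP => fk.
have Pf : P (find P (iota 0 (m i))).
  have hf : has P (iota 0 (m i)) by rewrite has_find size_iota (leq_ltn_trans fk).
  by have := nth_find 0%N hf; rewrite nth_iota ?add0n//; exact: leq_ltn_trans fk km.
move: fk Pf; set j := find _ _ => jk; rewrite /P => /negP; apply.
have {}kS l : (j <= l)%N -> (l <= k)%N -> (i, l) \in [seq label t | t <- enum S].
  move=> jl lk; rewrite -(subKn lk); elim: (k - l)%N (leq_subr l k) => [|r IH] rk;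
    first by rewrite subn0.
  have lt (s : nat) : (s <= k)%N -> exists t, label t = (i, s).
    by move=> sk; apply: labelP => /=; exact: leq_ltn_trans sk km.
  have [t1 e1] := lt (k - r)%N (leq_subr _ _).
  have [t2 e2] := lt (k - r.+1)%N (leq_subr _ _).
  have := IH (ltnW rk); rewrite -e1 -e2 !mem_label => t1S.
  by apply: (cS _ _ t1S); rewrite e1 e2 //= subnSK.
exact: kS.
Qed.

Lemma profile_lower m' : le_multinom m' -> profile (lower m') = m'.
Proof.
move=> m'm; apply/mpoly.mnmP => i; rewrite profileE.
rewrite (@eq_find _ _ (fun k => m' i <= k)%N); last first.
  by move=> k; rewrite (perm_mem (perm_lower m'm)) mem_boxes /= -leqNgt.
have := m'm i; move: (m' i) (m i) => a b ab.
rewrite -[b](subnKC ab) iotaD find_cat.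
case: ifP => [/hasP[k]|_]; first by rewrite mem_iota add0n /= => ka; rewrite leqNgt ka.
rewrite size_iota; case: (b - a)%N => [|c] /=; first by rewrite addn0.
by rewrite add0n leqnn addn0.
Qed.

Lemma sum_down_closed (V : nmodType) (F : {set 'I_d} -> V) a :
  (forall S, ~ down_closed S -> F S = 0) ->
  \sum_(S : {set 'I_d} | #|S| == a) F S =
  \sum_(m' : mpoly.bmultinom p d.+1 | [forall i, mpoly.bmnm m' i <= m i]%N &&
     (mdeg (mpoly.bmnm m') == a)) F (lower (mpoly.bmnm m')).
Proof.
move=> F0.
have pf S : (mdeg (profile S) < d.+1)%N.
  by rewrite ltnS !mpoly.mdegE; apply: leq_sum => i _; exact: profile_le.
rewrite (bigID (fun S => lower (profile S) == S)) /= [X in _ + X]big1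
  ?addr0; last first.
  by move=> S /andP[_ /eqP nS]; apply: F0 => /lower_profile.
rewrite (reindex_onto (fun m' : mpoly.bmultinom p d.+1 => lower (mpoly.bmnm m'))
  (fun S => mpoly.BMultinom (pf S))) /=; last by move=> S /andP[_ /eqP].
apply: eq_bigl => m'; apply/idP/idP.
  move=> /andP[/andP[/eqP <- _] /eqP e].
  have m'E : profile (lower (mpoly.bmnm m')) = mpoly.bmnm m' by rewrite -{2}e.
  have le : le_multinom (mpoly.bmnm m') by rewrite -m'E; exact: profile_le.
  by rewrite card_lower// eqxx andbT; apply/fintype.forallP.
move=> /andP[/fintype.forallP le /eqP <-].
rewrite card_lower// eqxx /=; apply/andP; split; first by rewrite profile_lower.
by apply/eqP/val_inj; rewrite /= profile_lower.
Qed.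
End Labels.
End Boxes.

(** * Convergence of complex series *)

Section ComplexLimits.
Local Open Scope classical_set_scope.
Local Open Scope complex_scope.
Context {R : realType}.
Notation C := (Cplx R).

Lemma CnormE (z : C) : `|z| = (Normc.normc z)%:C :> C.
Proof. by []. Qed.

Lemma ltC_real (e : C) : 0 < e -> exists2 r : R, 0 < r & e = r%:C.
Proof. by case: e => a b; rewrite ltcE /= => /andP[/eqP -> a0]; exists a. Qed.

Lemma normc_ge0 (z : C) : 0 <= Normc.normc z.
Proof. by have := normr_ge0 z; rewrite CnormE ler0c. Qed.

Lemma normc_Re (z : C) : `|complex.Re z| <= Normc.normc z.
Proof. by have := normc_ge_Re z; rewrite CnormE lecR. Qed.

Lemma normc_Im (z : C) : `|complex.Im z| <= Normc.normc z.
Proof.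
case: z => a b /=; rewrite -(sqrtr_sqr b); apply: ler_wsqrtr.
by rewrite lerDr sqr_ge0.
Qed.

Lemma normc_le_ReIm (z : C) :
  Normc.normc z <= `|complex.Re z| + `|complex.Im z|.
Proof.
rewrite -lecR -CnormE [X in `|X|]complexE (le_trans (ler_normD _ _))//.
rewrite normrM rmorphD /= lerD//.
  by rewrite CnormE /= expr0n addr0 sqrtr_sqr.
by rewrite !CnormE -rmorphM lecR /= !expr0n /= add0r addr0 expr1n sqrtr1
  mul1r sqrtr_sqr.
Qed.

(** Norms of complex numbers are complex numbers; this lemma and the next ones
    convert between convergence in C and estimates by real numbers. *)
Lemma cvgC_squeeze (T : Type) (F : set_system T) {FF : Filter F} (f : T -> C)
    (l : C) (b : T -> R) :
  (\forall x \near F, Normc.normc (f x - l) <= b x) -> b x @[x --> F] --> (0 : R) ->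
  f x @[x --> F] --> l.
Proof.
move=> fb b0; apply/cvgrPdist_lt => e /ltC_real[r r0 ->].
have /cvgrPdist_lt/(_ r r0) H := b0.
near=> x.
rewrite distrC CnormE ltcR.
apply: le_lt_trans (_ : b x < r); first by near: x.
apply: le_lt_trans (ler_norm _) _; rewrite -normrN -sub0r.
by near: x.
Unshelve. all: by end_near. Qed.

Lemma cvgC_ReIm (T : Type) (F : set_system T) {FF : Filter F} (f : T -> C)
    (a b : R) :
  complex.Re (f x) @[x --> F] --> a -> complex.Im (f x) @[x --> F] --> b ->
  f x @[x --> F] --> ((a +i* b) : C).
Proof.
move=> fa fb; apply: (@cvgC_squeeze _ _ _ _ _
  (fun x => `|complex.Re (f x) - a| + `|complex.Im (f x) - b|)).
  apply: nearW => x; apply: le_trans (normc_le_ReIm _) _.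
  by case: (f x).
rewrite -[0 in X in _ --> X]addr0; apply: cvgD.
  by rewrite -(normr0 R) -(subrr a); apply: cvg_norm; apply: cvgB => //; exact: cvg_cst.
by rewrite -(normr0 R) -(subrr b); apply: cvg_norm; apply: cvgB => //; exact: cvg_cst.
Qed.

Lemma cvgC_near (T : Type) (F : set_system T) {FF : Filter F} (f : T -> C)
    (l : C) (r : R) : 0 < r -> f x @[x --> F] --> l ->
  \forall x \near F, Normc.normc (l - f x) < r.
Proof.
move=> r0 /cvgrPdist_lt /(_ r%:C); rewrite ltcR => /(_ r0).
by apply: filterS => x; rewrite CnormE ltcR.
Qed.

Lemma Re_sum (I : Type) (s : seq I) (P : pred I) (F : I -> C) :
  complex.Re (\sum_(i <- s | P i) F i) = \sum_(i <- s | P i) complex.Re (F i).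
Proof. by elim/big_rec2: _ => // i a b _ <-; case: (F i) b => ? ? []. Qed.

Lemma Im_sum (I : Type) (s : seq I) (P : pred I) (F : I -> C) :
  complex.Im (\sum_(i <- s | P i) F i) = \sum_(i <- s | P i) complex.Im (F i).
Proof. by elim/big_rec2: _ => // i a b _ <-; case: (F i) b => ? ? []. Qed.

Lemma normc_sum (I : Type) (s : seq I) (P : pred I) (F : I -> C) :
  Normc.normc (\sum_(i <- s | P i) F i) <= \sum_(i <- s | P i) Normc.normc (F i).
Proof.
elim/big_rec2: _ => [|i a b _ ab]; first by rewrite Normc.normc0.
by apply: le_trans (le_normcD _ _) _; rewrite lerD2l.
Qed.

(** Completeness of C, reduced to that of the reals by components. *)
Lemma is_cvg_seriesC (u : nat -> C) (B : nat -> R) :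
  cvgn (series B) -> (forall k, Normc.normc (u k) <= B k) ->
  cvgn (series u).
Proof.
move=> cB uB.
have B0 k : 0 <= B k := le_trans (normc_ge0 _) (uB k).
have cR (v : nat -> R) : (forall k, `|v k| <= B k) -> cvgn (series v).
  by move=> vB; apply: normed_cvg; apply: series_le_cvg B0 vB cB => k; exact: normr_ge0.
have /cvg_ex[a ca] : cvgn (series (fun k => complex.Re (u k))).
  by apply: cR => k; apply: le_trans (normc_Re _) _.
have /cvg_ex[b cb] : cvgn (series (fun k => complex.Im (u k))).
  by apply: cR => k; apply: le_trans (normc_Im _) _.
apply/cvg_ex; exists (a +i* b); apply: cvgC_ReIm.
  by under eq_fun do rewrite /series /= Re_sum.
by under eq_fun do rewrite /series /= Im_sum.
Qed.

Lemma normc_series_tail (u : nat -> C) (B : nat -> R) (N : nat) :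
  cvgn (series B) -> (forall k, Normc.normc (u k) <= B k) ->
  Normc.normc (limn (series u) - series u N) <= limn (series B) - series B N.
Proof.
move=> cB uB; have cu := is_cvg_seriesC cB uB.
have B0 k : 0 <= B k := le_trans (normc_ge0 _) (uB k).
apply/ler_addgt0Pr => e e0.
have H : \forall n \near \oo, Normc.normc (limn (series u) - series u n) < e.
  exact: cvgC_near.
have [n [/= nN hn]] := filter_ex (filterI (nbhs_infty_ge N) H).
have -> : limn (series u) - series u N =
  (series u n - series u N) + (limn (series u) - series u n) by ring.
apply: le_trans (le_normcD _ _) _; apply: lerD; last exact: ltW.
rewrite sub_series_geq//; apply: le_trans (normc_sum _ _ _) _.
apply: (@le_trans _ _ (series B n - series B N)).
  by rewrite sub_series_geq//; apply: ler_sum.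
apply: lerB => //; apply: nondecreasing_cvgn_le => //.
by apply: nondecreasing_series.
Qed.

(** Dominated convergence for series. The filter is arbitrary so that the lemma
    serves both for sequences of series and for derivatives: cut the series at
    a place where the tail of the bound B is small; the finite part converges
    and both tails are uniformly small. *)
Lemma tannery (T : Type) (F : set_system T) {FF : ProperFilter F}
    (t : T -> nat -> C) (l : nat -> C) (B : nat -> R) :
  cvgn (series B) ->
  (\forall x \near F, forall k, Normc.normc (t x k) <= B k) ->
  (forall k, t x k @[x --> F] --> l k) ->
  limn (series (t x)) @[x --> F] --> limn (series l).
Proof.
move=> cB tB tl.
have lB k : Normc.normc (l k) <= B k.
  apply/ler_addgt0Pr => e e0.
  have [x [/= /(_ k) h1 h2]] := filter_ex (filterI tB (cvgC_near e0 (tl k))).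
  rewrite addrC -(subrK (t x k) (l k)).
  by apply: le_trans (le_normcD _ _) _; apply: lerD => //; exact: ltW.
apply/cvgrPdist_lt => e /ltC_real[r r0 ->].
have r30 : 0 < r / 3 by lra.
have /cvgrPdist_lt/(_ _ r30)[N _ /(_ N (leqnn N)) HN] := cB.
have tN : limn (series B) - series B N < r / 3.
  by apply: le_lt_trans HN; exact: ler_norm.
have cN : series (t x) N @[x --> F] --> series l N.
  elim: N {HN tN} => [|k IH].
    have s0 u : series u 0%N = 0 :> C by rewrite seriesEnat /= big_geq.
    rewrite s0; under eq_fun do rewrite s0.
    exact: cvg_cst.
  rewrite (_ : (fun x => _) = (fun x => series (t x) k) + (fun x => t x k)).
    rewrite seriesSr.
    have h := @cvgD _ _ _ F FF _ _ _ _ IH (tl k).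
    exact: h.
  by apply/funext => x; rewrite seriesSr.
have cN' : \forall x \near F, Normc.normc (series l N - series (t x) N) < r / 3.
  exact: cvgC_near.
apply: filterS (filterI tB cN') => x [/= tBx cx].
rewrite CnormE ltcR.
have -> : limn (series l) - limn (series (t x)) =
  (limn (series l) - series l N) + ((series l N - series (t x) N) +
  - (limn (series (t x)) - series (t x) N)) by ring.
apply: le_lt_trans (le_normcD _ _) _.
have -> : r = r / 3 + (r / 3 + r / 3) by field.
apply: ltrD; first by apply: le_lt_trans tN; exact: normc_series_tail.
apply: le_lt_trans (le_normcD _ _) _; apply: ltrD => //.
by rewrite normcN; apply: le_lt_trans tN; exact: normc_series_tail.
Qed.
End ComplexLimits.

(** * The complex exponential *)

Section ComplexExponential.
Local Open Scope classical_set_scope.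
Local Open Scope complex_scope.
Context {R : realType}.
Notation C := (Cplx R).

Lemma small_o_at0 (f : R -> R) : f 0 = 0 -> is_derive (0 : R) 1 f 0 ->
  forall e : R, 0 < e -> exists2 d : R, 0 < d &
    forall a, `|a| < d -> `|f a| <= e * `|a|.
Proof.
move=> f0 df e e0.
have h := @ex_derive _ _ _ _ _ _ _ df; rewrite /derivable in h.
have h0 := @derive_val _ _ _ _ _ _ _ df; rewrite /derive in h0.
rewrite h0 in h; move: h.
move=> /cvgrPdist_le /(_ e e0).
rewrite near_withinE => /nbhs_ballP[d /= d0 H].
exists d => // a ad.
have [->|a0] := eqVneq a 0; first by rewrite f0 normr0 mulr0.
have := H a; rewrite /ball /= sub0r normrN => /(_ ad a0).
rewrite sub0r normrN addr0 f0 subr0 normrZ /= [_%:A]mulr1 normfV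
  ler_pdivrMl ?normr_gt0//.
by rewrite mulrC.
Qed.

Lemma cexpD (z w : C) : cexp (z + w) = cexp z * cexp w.
Proof.
case: z w => a b [c d]; rewrite /cexp /= expRD cosD sinD.
by apply/eqP; rewrite eq_complex /=; apply/andP; split; apply/eqP; ring.
Qed.

Lemma cexp0 : cexp (0 : C) = 1.
Proof. by rewrite /cexp /= expR0 cos0 sin0 mul1r. Qed.

Lemma cexp_neq0 (z : C) : cexp z != 0.
Proof.
apply/eqP => z0; have := cexpD z (- z).
by rewrite subrr cexp0 z0 mul0r => /eqP; rewrite oner_eq0.
Qed.

Lemma cexpMn (z : C) (k : nat) : cexp (k%:R * z) = cexp z ^+ k.
Proof.
elim: k => [|k IH]; first by rewrite mul0r cexp0.
by rewrite -natr1 mulrDl mul1r cexpD IH exprSr.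
Qed.

Lemma normc_cexp (z : C) : Normc.normc (cexp z) = expR (complex.Re z).
Proof.
rewrite /cexp Normc.normcM /= cos2Dsin2 sqrtr1 mulr1 expr0n addr0 sqrtr_sqr.
by rewrite ger0_norm// expR_ge0.
Qed.

(** Complex differentiability of the exponential at the origin. Its components
    expR a * cos b and expR a * sin b are expanded with the real derivatives at
    the origin of expR, cos and sin. *)
Lemma cexp_sub1_bound (e : R) : 0 < e -> exists2 d : R, 0 < d &
  forall h : C, Normc.normc h < d ->
    Normc.normc (cexp h - 1 - h) <= e * Normc.normc h.
Proof.
move=> e0.
pose f : R := Num.min (e / 6) 1.
have f0 : 0 < f by rewrite lt_min ltr01 andbT; lra.
have [fe f1] : f <= e / 6 /\ f <= 1 by rewrite !ge_min !lexx orbT.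
have [d1 d10 H1] : exists2 d : R, 0 < d & forall a, `|a| < d -> `|expR a - 1 -
  a| <= f * `|a|.
  apply: (@small_o_at0 (fun a => expR a - 1 - a)) => //.
    by rewrite expR0 subrr subr0.
  by apply: is_derive_eq; rewrite expR0 /GRing.scale /= !subr0 subrr.
have [d2 d20 H2] : exists2 d : R, 0 < d & forall a, `|a| < d ->
  `|cos a - 1| <= f * `|a|.
  apply: (@small_o_at0 (fun a => cos a - 1)) => //.
    by rewrite cos0 subrr.
  by apply: is_derive_eq; rewrite sin0 /GRing.scale /= !oppr0 addr0.
have [d3 d30 H3] : exists2 d : R, 0 < d & forall a, `|a| < d ->
  `|sin a - a| <= f * `|a|.
  apply: (@small_o_at0 (fun a => sin a - a)) => //.
    by rewrite sin0 subrr.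
  by apply: is_derive_eq; rewrite cos0 /GRing.scale /= subrr.
(* d4 keeps |expR a - 1| below e / 6, and expR a below 2, where |a| < d4. *)
pose d4 : R := Num.min (1 / 4) (e / 12).
have d40 : 0 < d4 by rewrite lt_min; apply/andP; split; lra.
have [d4a d4b] : d4 <= 1 / 4 /\ d4 <= e / 12 by rewrite !ge_min !lexx orbT.
clearbody d4 f.
exists (Num.min (Num.min d1 d2) (Num.min d3 d4)).
  by rewrite !lt_min d10 d20 d30 d40.
move=> h hn; apply: le_trans (normc_le_ReIm _) _.
move: hn (normc_Im h) (normc_Re h).
set n := Normc.normc h; case: h @n => a b n.
rewrite !lt_min => /andP[/andP[n1 n2] /andP[n3 n4]] /= bn an.
have {}H1 := H1 a (le_lt_trans an n1).
have {}H2 := H2 b (le_lt_trans bn n2).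
have {}H3 := H3 b (le_lt_trans bn n3).
have n0 : 0 <= n by apply: le_trans an.
have E1 : `|expR a - 1| <= 2 * n.
  have -> : expR a - 1 = (expR a - 1 - a) + a by ring.
  apply: le_trans (ler_normD _ _) _; have := normr_ge0 a; nra.
have E2 : expR a <= 2 by have := ler_norm (expR a - 1); lra.
have E3 := expR_ge0 a.
rewrite !mul0r subr0 addr0.
have -> : expR a * cos b - 1 - a = (expR a - 1 - a) + expR a * (cos b - 1) by ring.
have -> : expR a * sin b - 0 - b = expR a * (sin b - b) + (expR a - 1) * b by ring.
have X1 : `|expR a - 1 - a + expR a * (cos b - 1)| <= e / 2 * n.
  apply: le_trans (ler_normD _ _) _; rewrite normrM (ger0_norm E3).
  have := normr_ge0 (cos b - 1); have := normr_ge0 a; have := normr_ge0 b; nra.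
have X2 : `|expR a * (sin b - b) + (expR a - 1) * b| <= e / 2 * n.
  apply: le_trans (ler_normD _ _) _; rewrite !normrM (ger0_norm E3).
  have := normr_ge0 (sin b - b); have := normr_ge0 (expR a - 1);
    have := normr_ge0 b; nra.
lra.
Qed.

Lemma near_normc (d : R) : 0 < d ->
  \forall h \near (0 : C), Normc.normc h < d.
Proof.
move=> d0; apply/nbhs_ballP; exists d%:C; first by rewrite /= ltcR.
by move=> h; rewrite /ball /= sub0r normrN CnormE ltcR.
Qed.

Lemma cvgC_quotient (f : C -> C) (l : C) :
  (forall e : R, 0 < e -> \forall h \near (0 : C),
     Normc.normc (f h - l * h) <= e * Normc.normc h) ->
  (h : C)^-1 * f h @[h --> 0^'] --> l.
Proof.
move=> H; apply/cvgrPdist_le => e /ltC_real[r r0 ->].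
rewrite near_withinE; apply: filterS (H r r0) => h hf h0.
have nh : 0 < Normc.normc h.
  rewrite lt_def normc_ge0 andbT; apply/eqP => /Normc.eq0_normc h00.
  by rewrite h00 eqxx in h0.
rewrite distrC (_ : _ - l = h^-1 * (f h - l * h)); last first.
  by rewrite mulrBr mulrCA mulVf// mulr1.
by rewrite CnormE lecR Normc.normcM Normc.normcV ler_pdivrMl// [leRHS]mulrC.
Qed.

Lemma differentiable_cexp (z : C) : differentiable (cexp : C -> C) z.
Proof.
apply/derivable1_diffP; apply/cvg_ex; exists (cexp z).
have -> : (fun h : C => h^-1 *: ((cexp \o shift z) (h *: 1) - cexp z)) =
          (fun h : C => h^-1 * (cexp (h + z) - cexp z)).
  by apply/funext => h /=; rewrite [_%:A]mulr1.
apply: cvgC_quotient => e e0.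
have nz : 0 < Normc.normc (cexp z) by rewrite normc_cexp expR_gt0.
have [d d0 H] := cexp_sub1_bound (divr_gt0 e0 nz).
apply: filterS (near_normc d0) => h /H hb.
rewrite cexpD (_ : _ - _ = cexp z * (cexp h - 1 - h)); last by ring.
by rewrite Normc.normcM; move: hb; rewrite mulrAC ler_pdivlMr// mulrC.
Qed.

(** The modulus forces the real part to vanish; the imaginary part is reduced
    modulo 2 pi to a point of [0, 2 pi[ where the cosine is 1, and injectivity
    of the cosine on [0, pi], used for it or for its reflection, shows that the
    point is 0. *)
Lemma cexp_eq1 (z : C) : cexp z = 1 ->
  exists k : int, z = 2 * (k%:~R * (pi : R))%:C * 'i%C.
Proof.
case: z => a b; move=> h.
have a0 : a = 0.
  have := normc_cexp (a +i* b); rewrite h Normc.normc1 /= -expR0.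
  by move/expR_inj.
move: h; rewrite a0 /cexp /= expR0 mul1r => -[cb sb] {a0}.
have pi0 := pi_gt0 R.
pose k := Num.floor (b / (pi *+ 2)).
pose r := b - k%:~R * (pi *+ 2).
have cr : cos r = 1.
  rewrite -cb; case: k @r => m /=.
    by rewrite -(periodicn (@cosD2pi R) m (b - m%:R * (pi *+ 2))); congr cos;
      rewrite -mulr_natl; ring.
  rewrite -(periodicn (@cosD2pi R) m.+1 b); congr cos.
  have -> : (Negz m)%:~R = - m.+1%:R :> R by rewrite NegzE mulrNz.
  by rewrite mulNr opprK mulr_natl.
have [r0 r2] : 0 <= r /\ r < pi *+ 2.
  have /andP := floor_itv (b / (pi *+ 2)).
  have p2 : 0 < pi *+ 2 :> R by rewrite mulrn_wgt0.
  rewrite -/k ler_pdivlMr// ltr_pdivrMr// intrD mulrDl mul1r => -[h1 h2].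
  by rewrite /r subr_ge0 ltrBlDl; split.
have r00 : r = 0.
  have [rp|rp] := leP r pi.
    apply: (@cos_inj R) => //; rewrite ?in_itv /= ?r0 ?rp ?lexx ?(ltW pi0)//.
    by rewrite cr cos0.
  have : pi *+ 2 - r = 0.
    apply: (@cos_inj R); rewrite ?in_itv /= ?lexx ?(ltW pi0)//.
      by apply/andP; split; rewrite mulr2n in r2 *; lra.
    by rewrite cosB cos2pi sin2pi mul0r addr0 mul1r cr cos0.
  by move=> h; move: r2; rewrite mulr2n in h *; lra.
exists k; apply/eqP; rewrite eq_complex /=; apply/andP; split; apply/eqP; first by ring.
move: r00; rewrite /r => /eqP; rewrite subr_eq0 => /eqP ->.
by rewrite mulr2n; ring.
Qed.
End ComplexExponential.

(** * Entire power series *)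

Section PowerSeries.
Local Open Scope classical_set_scope.
Local Open Scope complex_scope.
Context {R : realType}.
Notation C := (Cplx R).

Lemma bin2S k : 'C(k.+1, 2) = ('C(k, 2) + k)%N.
Proof. by rewrite binS bin1. Qed.

(** The quotient of consecutive terms is Q^k r, eventually at most 1/2, so the
    terms are dominated by a geometric sequence. *)
Lemma cvg_series_gauss (Q r : R) : 0 <= Q < 1 -> 0 <= r ->
  cvgn (series (fun k => Q ^+ 'C(k, 2) * r ^+ k)).
Proof.
move=> /andP[Q0 Q1] r0; set b := (fun k => _).
have b0 k : 0 <= b k by rewrite mulr_ge0 ?exprn_ge0.
have bS k : b k.+1 = b k * (Q ^+ k * r) by rewrite /b bin2S exprD exprS; ring.
(* Q^k r is the quotient of b (k + 1) by b k. *)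
have [K HK] : exists K : nat, forall k, (K <= k)%N -> Q ^+ k * r <= 2^-1.
  have Qr : `|Q| < 1 by rewrite ger0_norm.
  have /cvgrPdist_le/(_ 2^-1) := cvg_geometric r Qr.
  rewrite invr_gt0 => /(_ (ltr0Sn _ _))[K _ H]; exists K => k /H.
  by rewrite sub0r normrN /geometric /= mulrC => /(le_trans (ler_norm _)).
(* M / 2^k is at least b k for k <= K, where the bound on the ratios starts. *)
pose M := \sum_(j < K.+1) b j * 2 ^+ j.
have bM k : b k <= M * 2^-1 ^+ k.
  have [kK|] := leqP k K.
    rewrite exprVn ler_pdivlMr ?exprn_gt0// /M (bigD1 (Ordinal (kK : (k < K.+1)%N)))//=.
    by rewrite lerDl sumr_ge0// => i _; rewrite mulr_ge0 ?exprn_ge0.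
  elim: k => // k IH Kk.
  have {}IH : b k <= M * 2^-1 ^+ k.
    move: Kk; rewrite ltnS leq_eqVlt => /orP[/eqP <-|/IH//].
    rewrite exprVn ler_pdivlMr ?exprn_gt0// /M big_ord_recr /=.
    by rewrite lerDr sumr_ge0// => i _; rewrite mulr_ge0 ?exprn_ge0.
  rewrite bS exprSr [leRHS]mulrA; have Hk := HK k Kk.
  by apply: ler_pM => //; rewrite mulr_ge0 ?exprn_ge0.
have M0 k := le_trans (b0 k) (bM k).
apply: series_le_cvg b0 M0 bM _.
apply: (@is_cvg_geometric_series R M 2^-1).
by rewrite ger0_norm ?invr_ge0// invf_lt1 ?ltr1n.
Qed.

Lemma normcX (x : C) k : Normc.normc (x ^+ k) = Normc.normc x ^+ k.
Proof.
elim: k => [|k IH]; first by rewrite !expr0 Normc.normc1.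
by rewrite !exprS Normc.normcM IH.
Qed.

Lemma ler_natr_expr2 (k : nat) : k%:R <= 2 ^+ k :> R.
Proof. by rewrite -natrX ler_nat ltnW// ltn_expl. Qed.

(** Factor y - x out of the difference of powers; the k terms of the cofactor are
    at most rho^k, and k <= 2^k. *)
Lemma subrX_quotient_bound (x y : C) (rho : R) k : 1 <= rho ->
  Normc.normc x <= rho -> Normc.normc y <= rho ->
  Normc.normc (y ^+ k - x ^+ k) <= Normc.normc (y - x) * (2 * rho) ^+ k.
Proof.
move=> r1 xr yr; have r0 : 0 <= rho by lra.
rewrite subrXX Normc.normcM ler_wpM2l ?normc_ge0//.
apply: le_trans (normc_sum _ _ _) _.
apply: (@le_trans _ _ (\sum_(i < k) rho ^+ k)).
  apply: ler_sum => i _; rewrite Normc.normcM !normcX.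
  rewrite (_ : rho ^+ k = rho ^+ (k.-1 - i) * rho ^+ i * rho); last first.
    by rewrite -exprD -exprSr; congr (_ ^+ _); have := ltn_ord i; lia.
  rewrite -[leLHS]mulr1; apply: ler_pM => //; rewrite ?mulr_ge0 ?exprn_ge0 ?normc_ge0//.
  have X (z : C) j : Normc.normc z <= rho -> Normc.normc z ^+ j <= rho ^+ j.
    by move=> zr; apply: lerXn2r; rewrite ?nnegrE ?normc_ge0.
  by apply: ler_pM; rewrite ?exprn_ge0 ?normc_ge0 ?X.
rewrite sumr_const card_ord -[rho ^+ k *+ k]mulr_natl exprMn ler_wpM2r ?exprn_ge0//.
exact: ler_natr_expr2.
Qed.

Definition pseriesC (a : nat -> C) (x : C) : C :=
  limn (series (fun k => a k * x ^+ k)).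

(** Infinite radius of convergence. *)
Definition entire_coefs (a : nat -> C) : Prop :=
  forall r : R, 0 <= r -> cvgn (series (fun k => Normc.normc (a k) * r ^+ k)).

Lemma is_cvg_pseriesC a x : entire_coefs a -> cvgn (series (fun k => a k * x ^+ k)).
Proof.
move=> /(_ _ (normc_ge0 x)) ca; apply: is_cvg_seriesC ca _ => k.
by rewrite Normc.normcM normcX.
Qed.

(** Termwise differentiation is dominated convergence for the difference
    quotients, which are bounded by the absolute series at 2 (|x| + 1). *)
Lemma differentiable_pseriesC a (x : C) : entire_coefs a ->
  differentiable (pseriesC a) x.
Proof.
move=> ca; apply/derivable1_diffP; apply/cvg_ex.
pose t (h : C) k := h^-1 * (a k * (h + x) ^+ k - a k * x ^+ k).
exists (limn (series (fun k => a k * 'D_1 (fun x : C => x ^+ k) x))).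
have -> : (fun h : C => h^-1 *: ((pseriesC a \o shift x) (h *: 1) - pseriesC a x)) =
          (fun h : C => limn (series (t h))).
  apply/funext => h /=; rewrite [_%:A]mulr1.
  have c1 := @is_cvg_pseriesC a (h + x) ca.
  have c2 := @is_cvg_pseriesC a x ca.
  have := lim_seriesB c1 c2; rewrite /pseriesC => <-.
  have c3 := is_cvg_seriesB c1 c2.
  have := lim_seriesZ (h^-1) c3 => <-.
  by [].
pose rho := Normc.normc x + 1.
have r1 : 1 <= rho by rewrite lerDr normc_ge0.
have r0 : 0 <= 2 * rho by lra.
apply: tannery (ca _ r0) _ _.
  rewrite near_withinE; apply: filterS (near_normc (@ltr01 R)) => h h1 h0 k.
  rewrite /t -mulrBr mulrCA Normc.normcM ler_wpM2l ?normc_ge0//.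
  have nh : 0 < Normc.normc h.
    rewrite lt_def normc_ge0 andbT; apply/eqP => /Normc.eq0_normc h00.
    by rewrite h00 eqxx in h0.
  rewrite Normc.normcM Normc.normcV ler_pdivrMl//.
  have hx : Normc.normc (h + x) <= rho.
    by apply: le_trans (le_normcD _ _) _; rewrite /rho addrC lerD2l ltW.
  have xr : Normc.normc x <= rho by rewrite /rho; lra.
  by have := subrX_quotient_bound k r1 xr hx; rewrite addrK.
move=> k.
have -> : t^~ k = (fun h => a k * (h^-1 * ((h + x) ^+ k - x ^+ k))).
  by apply/funext => h; rewrite /t -mulrBr mulrCA.
apply: cvgMr.
have := @exprn_derivable C k x 1; rewrite /derivable /derive.
by under eq_fun do rewrite /= [_%:A]mulr1.
Qed.
End PowerSeries.

(** * The theta series *)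

Section ThetaSeries.
Local Open Scope classical_set_scope.
Local Open Scope complex_scope.
Context {R : realType} (tau : Cplx R).
Hypothesis tau_gt0 : 0 < complex.Im tau.
Notation C := (Cplx R).

(** The usual q = exp(2 pi i tau). *)
Definition nome : C := cexp (twopii * tau).

(** The coefficients of the Laurent series of theta in exp(2 pi i z): theta_pos
    for the exponents k >= 0 and theta_neg for the exponents - k - 1. *)
Definition theta_pos (k : nat) : C := (-1) ^+ k * nome ^+ 'C(k, 2).
Definition theta_neg (k : nat) : C := (-1) ^+ k.+1 * nome ^+ 'C(k.+2, 2).

Lemma normc_nome : 0 <= Normc.normc nome < 1.
Proof.
rewrite normc_ge0 normc_cexp -[ltRHS]expR0 ltr_expR; case: tau tau_gt0 => a b /= b0.
by have pi0 := pi_gt0 R; simpl; nra.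
Qed.

Lemma normc_signM k (z : C) : Normc.normc ((-1) ^+ k * z) = Normc.normc z.
Proof. by rewrite Normc.normcM normcX normcN Normc.normc1 expr1n mul1r. Qed.

Lemma entire_theta_pos : entire_coefs theta_pos.
Proof.
move=> r r0; have := cvg_series_gauss normc_nome r0.
rewrite (_ : (fun k => _) = (fun k => Normc.normc (theta_pos k) * r ^+ k))//.
by apply/funext => k; rewrite /theta_pos normc_signM normcX.
Qed.

Lemma entire_theta_neg : entire_coefs theta_neg.
Proof.
move=> r r0; have /andP[q0 q1] := normc_nome.
apply: series_le_cvg (entire_theta_pos r0) => k.
- by rewrite mulr_ge0 ?exprn_ge0 ?normc_ge0.
- by rewrite mulr_ge0 ?exprn_ge0 ?normc_ge0.
rewrite ler_wpM2r ?exprn_ge0// /theta_neg /theta_pos !normc_signM !normcX.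
apply: ler_wiXn2l; rewrite ?q0 ?(ltW q1)//.
by rewrite !bin2S -addnA leq_addr.
Qed.

Lemma mulz_pred_bin2 (k : nat) : k%:Z * (k%:Z - 1) = (2 * 'C(k, 2))%N%:Z.
Proof.
elim: k => [|k IH]; first by rewrite mul0r.
by rewrite bin2S mulnDr PoszD -IH intS PoszM; ring.
Qed.

Lemma theta_term_pos z k :
  theta_term tau z k%:Z = theta_pos k * cexp (twopii * z) ^+ k.
Proof.
rewrite /theta_term mulz_pred_bin2.
have -> : twopii * (k%:Z%:~R * z + (2 * 'C(k, 2))%N%:Z%:~R / 2 * tau) =
  k%:R * (twopii * z) + 'C(k, 2)%:R * (twopii * tau) :> C.
  by rewrite -!pmulrn natrM; field.
by rewrite cexpD !cexpMn /theta_pos -exprnP; ring.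
Qed.

Lemma theta_term_neg z k :
  theta_term tau z (- k.+1%:Z) =
  cexp (- (twopii * z)) * (theta_neg k * cexp (- (twopii * z)) ^+ k).
Proof.
rewrite /theta_term.
have -> : - k.+1%:Z * (- k.+1%:Z - 1) = k.+2%:Z * (k.+2%:Z - 1).
  by rewrite [k.+2%:Z]intS; ring.
rewrite mulz_pred_bin2.
have -> : twopii * ((- k.+1%:Z)%:~R * z + (2 * 'C(k.+2, 2))%N%:Z%:~R / 2 * tau) =
  k.+1%:R * - (twopii * z) + 'C(k.+2, 2)%:R * (twopii * tau) :> C.
  by rewrite intrN -!pmulrn natrM; field.
rewrite cexpD !cexpMn /theta_neg -exprnN invr_sign.
by rewrite -/nome [cexp _ ^+ k.+1]exprS; ring.
Qed.

Lemma thetaE z : theta tau z = pseriesC theta_pos (cexp (twopii * z)) +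
  cexp (- (twopii * z)) * pseriesC theta_neg (cexp (- (twopii * z))).
Proof.
rewrite /theta; congr (_ + _).
  by rewrite /pseriesC; congr (limn (series _)); apply/funext => k;
    exact: theta_term_pos.
have c := @is_cvg_pseriesC R theta_neg (cexp (- (twopii * z))) entire_theta_neg.
apply: etrans (lim_seriesZ (cexp (- (twopii * z))) c).
by congr (limn (series _)); apply/funext => k; exact: theta_term_neg.
Qed.

Lemma differentiable_theta z : differentiable (theta tau) z.
Proof.
have -> : theta tau = pseriesC theta_pos \o cexp \o ( *%R twopii) +
  (cexp \o -%R \o ( *%R twopii)) * (pseriesC theta_neg \o cexp \o -%R \o ( *%R twopii)).
  by apply/funext => w; exact: thetaE.
have dI w : differentiable (id : C -> C) w.
  by apply/derivable1_diffP; exact: derivable_id.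
have dM w : differentiable ( *%R (twopii : C)) w.
  by apply: differentiableM; [exact: differentiable_cst|exact: dI].
have dN w : differentiable (-%R : C -> C) w.
  by apply: differentiableN; exact: dI.
have dE w : differentiable (cexp : C -> C) w by exact: differentiable_cexp.
have dP w := differentiable_pseriesC w entire_theta_pos.
have dQ w := differentiable_pseriesC w entire_theta_neg.
apply: differentiableD; last apply: differentiableM.
- exact: differentiable_comp (differentiable_comp (dM _) (dE _)) (dP _).
- exact: differentiable_comp (differentiable_comp (dM _) (dN _)) (dE _).
- exact: differentiable_comp (dM _) (differentiable_comp (dN _)
  (differentiable_comp (dE _) (dQ _))).
Qed.

(** The terms of index a and 1 - a cancel at the origin. *)
Lemma theta0 : theta tau 0 = 0.
Proof.
rewrite thetaE mulr0 oppr0 cexp0 mul1r.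
have c1 := @is_cvg_pseriesC R theta_pos 1 entire_theta_pos.
have c2 := @is_cvg_pseriesC R theta_neg 1 entire_theta_neg.
have h n : series (fun k => theta_pos k * 1 ^+ k) n.+2 =
  - series (fun k => theta_neg k * 1 ^+ k) n.
  elim: n => [|n IH].
    rewrite !seriesSr; have s0 u : series u 0%N = 0 :> C by rewrite
      seriesEnat /= big_geq.
    by rewrite !s0 /theta_pos /= !bin0n !bin_small //=; ring.
  rewrite seriesSr IH [in RHS]seriesSr opprD; congr (_ + _).
  by rewrite /theta_pos /theta_neg !exprS; ring.
have cB : series (fun k => theta_pos k * 1 ^+ k) @ \oo --> - pseriesC theta_neg 1.
  rewrite -(cvg_shiftn 2).
  rewrite (_ : (fun n => _) = - series (fun k => theta_neg k * 1 ^+ k)).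
    exact: cvgN.
  by apply/funext => n; rewrite addn2 h.
have -> : pseriesC theta_pos 1 = - pseriesC theta_neg 1.
  exact: (cvg_unique (@norm_hausdorff _ C) c1 cB).
by rewrite addNr.
Qed.
End ThetaSeries.

(** * Infinite products and the zeros of theta *)

Section InfiniteProducts.
Local Open Scope classical_set_scope.
Local Open Scope complex_scope.
Context {R : realType}.
Notation C := (Cplx R).

Lemma cvgC_bounded (u : nat -> C) (l : C) : u @ \oo --> l ->
  exists D : R, forall k, Normc.normc (u k) <= D.
Proof.
move=> ul.
have [K _ HK] : \forall k \near \oo, Normc.normc (l - u k) < 1 by exact: cvgC_near.
pose S := \sum_(j < K) Normc.normc (u j).
have S0 : 0 <= S by apply: sumr_ge0 => j _; exact: normc_ge0.
exists (Normc.normc l + 1 + S) => k.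
have l0 := normc_ge0 l.
have [kK|Kk] := ltnP k K.
  have : Normc.normc (u k) <= S.
    rewrite /S (bigD1 (Ordinal kK))//= lerDl; apply: sumr_ge0 => j _; exact: normc_ge0.
  by lra.
have := HK k Kk => h.
have := le_normcD l (- (l - u k)); rewrite normcN opprB addrC subrK.
by simpl in *; lra.
Qed.

(** The partial products are bounded by the exponential of the sum of the bounds,
    so their increments form an absolutely convergent series. *)
Lemma cvg_prodC (a : nat -> C) (B : nat -> R) : cvgn (series B) ->
  (forall k, Normc.normc (a k) <= B k) ->
  cvgn (fun M : nat => \prod_(k < M) (1 - a k)).
Proof.
move=> cB aB; pose P (M : nat) := \prod_(k < M) (1 - a k).
have B0 k : 0 <= B k := le_trans (normc_ge0 _) (aB k).
have PE M : Normc.normc (P M) <= expR (limn (series B)).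
  apply: (@le_trans _ _ (expR (series B M))); last first.
    rewrite ler_expR; apply: nondecreasing_cvgn_le => //.
    by apply: nondecreasing_series.
  elim: M => [|M IH].
    by rewrite /P big_ord0 Normc.normc1 seriesEnat /= big_geq// expR0.
  rewrite /P big_ord_recr /= Normc.normcM seriesSr expRD.
  apply: ler_pM; rewrite ?normc_ge0//.
  apply: le_trans (le_normcD _ _) _; rewrite Normc.normc1 normcN.
  by apply: le_trans (expR_ge1Dx _); rewrite lerD2l.
have PS M : P M = 1 + series (fun k => - (a k * P k)) M.
  elim: M => [|M IH]; first by rewrite /P big_ord0 seriesEnat /= big_geq// addr0.
  by rewrite seriesSr addrA -IH {1}/P big_ord_recr /= -/(P M); ring.
have : cvgn (series (fun k => - (a k * P k))).
  apply: (@is_cvg_seriesC _ _ (expR (limn (series B)) *: B)).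
    exact: is_cvg_seriesZ.
  move=> k; rewrite normcN Normc.normcM mulrC.
  by apply: (ler_pM (normc_ge0 _) (normc_ge0 _) (PE k) (aB k)).
move=> /cvg_ex[l cl]; apply/cvg_ex; exists (1 + l).
rewrite (_ : (fun M : nat => _) = cst 1 + series (fun k => - (a k * P k))).
  exact: (cvgD (@cvg_cst _ (1 : C) _ \oo _) cl).
by apply/funext => M; exact: PS.
Qed.

(** The product of the inverses is again of the form 1 - b with b summable, so it
    converges as well; the product of the two limits is 1. *)
Lemma cvg_prodC_neq0 (a : nat -> C) (B : nat -> R) : cvgn (series B) ->
  (forall k, Normc.normc (a k) <= B k) -> (forall k, 1 - a k != 0) ->
  exists2 l : C, l != 0 & (fun M : nat => \prod_(k < M) (1 - a k)) @ \oo --> l.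
Proof.
move=> cB aB a1; have /cvg_ex[l cl] := cvg_prodC cB aB.
have B0 k : 0 <= B k := le_trans (normc_ge0 _) (aB k).
have [D HD] : exists D : R, forall k, Normc.normc (1 - a k)^-1 <= D.
  apply: (@cvgC_bounded _ 1).
  rewrite -[X in _ --> X]invr1; apply: cvgV; first exact: oner_neq0.
  rewrite -[X in _ --> X]subr0; apply: cvgB; first exact: cvg_cst.
  apply: (@cvgC_squeeze _ _ _ _ _ _ B); last exact: cvg_series_cvg_0.
  by apply: nearW => k; rewrite subr0.
have /cvg_ex[l' cl'] : cvgn (fun M : nat => \prod_(k < M) (1 - - (a k / (1 - a k)))).
  apply: (@cvg_prodC (fun k => - (a k / (1 - a k))) (D *: B)).
    exact: is_cvg_seriesZ.
  move=> k; rewrite normcN Normc.normcM mulrC.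
  by apply: (ler_pM (normc_ge0 _) (normc_ge0 _) (HD k) (aB k)).
exists l; last exact: cl.
apply/eqP => l0.
have e : (fun M : nat => \prod_(k < M) (1 - a k)) *
    (fun M : nat => \prod_(k < M) (1 - - (a k / (1 - a k)))) = cst 1.
  apply/funext => M; apply: etrans (esym (big_split _ _ _ _ _)) _.
  rewrite big1//= => k _.
  by field; exact: a1.
have h : (cst 1 : nat -> C) @ \oo --> l * l'.
  by rewrite -e; exact: (cvgM cl cl').
have : l * l' = 1 by exact: (cvg_unique (@norm_hausdorff _ C) h
  (@cvg_cst _ (1 : C) _ \oo _)).
by rewrite l0 mul0r => /esym/eqP; rewrite oner_eq0.
Qed.
End InfiniteProducts.

Section FiniteTripleProduct.
Context {F : fieldType} (q : F).
Hypothesis q1 : forall k : nat, 1 - q ^+ k.+1 != 0.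

Definition qpoch (n : nat) : F := \prod_(k < n) (1 - q ^+ k.+1).

Definition qbinom (n j : nat) : F :=
  if (j <= n)%N then qpoch n / (qpoch j * qpoch (n - j)) else 0.

Lemma qpochS n : qpoch n.+1 = qpoch n * (1 - q ^+ n.+1).
Proof. by rewrite /qpoch big_ord_recr. Qed.

Lemma qpoch_neq0 n : qpoch n != 0.
Proof. by rewrite prodf_seq_neq0; apply/allP => k _; exact: q1. Qed.

Lemma qbinom0 n : qbinom n 0 = 1.
Proof. by rewrite /qbinom /= subn0 {2}/qpoch big_ord0 mul1r divff ?qpoch_neq0. Qed.

Lemma qbinomS n j : (j <= n)%N ->
  qbinom n.+1 j.+1 = qbinom n j.+1 + q ^+ (n - j) * qbinom n j.
Proof.
rewrite leq_eqVlt => /orP[/eqP->|jn].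
  rewrite /qbinom ltnn !leqnn !subnn /= /qpoch !big_ord0 !mulr1 add0r mul1r.
  by rewrite !divff ?qpoch_neq0.
rewrite /qbinom ltnS (ltnW jn) jn subSS.
have [m nE] : exists m, n = (j + m).+1 by exists (n - j.+1)%N; lia.
have -> : (n - j = m.+1)%N by lia.
have -> : (n - j.+1 = m)%N by lia.
rewrite !qpochS.
have h1 := qpoch_neq0 j; have h2 := qpoch_neq0 m; have h3 := q1 j; have h4 := q1 m.
have -> : q ^+ n.+1 = q ^+ m.+1 * q ^+ j.+1 by rewrite -exprD; congr (_ ^+ _); lia.
by field; rewrite h1 h2 h3 h4.
Qed.

Lemma qbinom_small n j : (n < j)%N -> qbinom n j = 0.
Proof. by rewrite ltnNge /qbinom => /negbTE ->. Qed.

(** The q-binomial theorem, by Pascal's rule qbinomS. *)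
Lemma qbinom_thm n x :
  \prod_(k < n) (1 - q ^+ k * x) =
  \sum_(j < n.+1) (-1) ^+ j * q ^+ 'C(j, 2) * qbinom n j * x ^+ j.
Proof.
elim: n => [|n IH].
  by rewrite big_ord0 big_ord_recl big_ord0 qbinom0 /= bin0n /=; ring.
rewrite big_ord_recr /= IH [RHS]big_ord_recl mulrBr mulr1.
rewrite [X in X - _](_ : _ = 1 + \sum_(j < n.+1) (-1) ^+ j.+1 * q ^+ 'C(j.+1, 2) *
  qbinom n j.+1 * x ^+ j.+1); last first.
  rewrite big_ord_recl qbinom0 /= bin0n big_ord_recr /= qbinom_small//
    mulr0 mul0r addr0.
  by congr (_ + _); ring.
rewrite qbinom0 bin0n !expr0 !mulr1 -addrA; congr (1 + _).
rewrite mulr_suml -sumrB; apply: eq_bigr => j _; rewrite lift0.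
have jn : (j <= n)%N by rewrite -ltnS.
rewrite qbinomS// bin2S !exprD !exprS.
have -> : q ^+ n = q ^+ j * q ^+ (n - j) by rewrite -exprD subnKC.
by ring.
Qed.

Lemma qbinom_sym n j : (j <= n)%N -> qbinom n (n - j) = qbinom n j.
Proof. by move=> jn; rewrite /qbinom leq_subr jn subKn// [qpoch j * _]mulrC. Qed.

Lemma prod_expr_sub M : \prod_(k < M) q ^+ (M - k) = q ^+ 'C(M.+1, 2).
Proof.
elim: M => [|M IH]; first by rewrite big_ord0.
rewrite big_ord_recl subn0 [in RHS]bin2S exprD -IH mulrC.
by congr (_ * _); apply: eq_bigr => k _; rewrite lift0.
Qed.

Lemma bin2D m k : 'C(m + k, 2) = ('C(m, 2) + 'C(k, 2) + m * k)%N.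
Proof.
elim: k => [|k IH]; first by rewrite addn0 muln0 !addn0.
by rewrite addnS !bin2S IH; lia.
Qed.

Lemma bin2_sqr m : ('C(m, 2) + 'C(m.+1, 2) = m * m)%N.
Proof. by elim: m => // m IH; have := bin2S m; have := bin2S m.+1; lia. Qed.

(** The q-binomial theorem with 2 M factors, at x / q^M: half of the factors give
    the product in x, and the other half, after multiplication by the
    monomials - q^(M - k) y, the product in y = 1 / x. On the other side the
    summation index is recentred at M, and the sign, the powers of q and the monomials
    are collected in w. *)
Lemma finite_triple_product (x y : F) M : q != 0 -> x * y = 1 ->
  (\prod_(k < M) (1 - q ^+ k * x)) * \prod_(k < M) (1 - q ^+ k.+1 * y) =
  \sum_(k < M.+1) (-1) ^+ k * q ^+ 'C(k, 2) * x ^+ k * qbinom (M + M) (M + k) +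
  y * \sum_(k < M) (-1) ^+ k.+1 * q ^+ 'C(k.+2, 2) * y ^+ k * qbinom (M + M) (M + k.+1).
Proof.
move=> q0 xy.
have y0 : y != 0 by apply: contra_eq_neq xy => ->; rewrite mulr0 eq_sym oner_neq0.
pose t := q ^+ M.
have t0 : t != 0 by rewrite expf_neq0.
(* w is the product of the monomials - q^(M - k) y for k < M. *)
pose w := (-1) ^+ M * q ^+ 'C(M.+1, 2) * y ^+ M.
have -> : (\prod_(k < M) (1 - q ^+ k * x)) * \prod_(k < M) (1 - q ^+ k.+1 * y) =
  w * \prod_(k < M + M) (1 - q ^+ k * (t^-1 * x)).
  rewrite big_split_ord /= mulrA mulrC; congr (_ * _); last first.
    by apply: eq_bigr => k _; rewrite exprD -/t; field.
  have -> : w = \prod_(k < M) - (q ^+ (M - k) * y).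
    rewrite prodrN card_ord big_split /= prodr_const card_ord /w mulrA.
    by rewrite prod_expr_sub.
  rewrite -big_split /= [LHS](reindex_inj rev_ord_inj) /=.
  apply: eq_bigr => k _.
  have kM := ltn_ord k.
  have -> : t = q ^+ k * q ^+ (M - k) by rewrite -exprD subnKC// ltnW.
  have -> : x = y^-1 by apply: (mulIf y0); rewrite xy mulVf.
  have -> : ((M - k.+1).+1 = M - k)%N by lia.
  by field; rewrite y0 !expf_neq0.
have w1 : w * x ^+ M = (-1) ^+ M * q ^+ 'C(M.+1, 2).
  by rewrite /w -mulrA -exprMn [y * x]mulrC xy expr1n mulr1.
rewrite qbinom_thm -addnS big_split_ord /= addrC mulrDr; congr (_ + _).
- rewrite mulr_sumr; apply: eq_bigr => k _.
  have e : q ^+ 'C(M.+1, 2) * q ^+ 'C(M + k, 2) = q ^+ 'C(k, 2) * t ^+ (M + k).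
    by rewrite -exprM -!exprD; congr (_ ^+ _); have := bin2_sqr M; rewrite bin2D; lia.
  have s : (-1) ^+ M * (-1) ^+ (M + k) = (-1) ^+ k :> F.
    by rewrite exprD mulrA -exprD addnn -mul2n exprM sqrrN !expr1n mul1r.
  have tt : t ^+ (M + k) != 0 by rewrite expf_neq0.
  transitivity (w * x ^+ M * ((-1) ^+ (M + k) * q ^+ 'C(M + k, 2) * (t ^+ (M + k))^-1 *
    x ^+ k * qbinom (M + M) (M + k))).
    by rewrite exprMn exprVn [x ^+ (M + k)]exprD; ring.
  rewrite w1; transitivity (((-1) ^+ M * (-1) ^+ (M + k)) *
    (q ^+ 'C(M.+1, 2) * q ^+ 'C(M + k, 2)) *
    (t ^+ (M + k))^-1 * x ^+ k * qbinom (M + M) (M + k)); first by ring.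
  by rewrite s e; field.
rewrite mulr_sumr [RHS]mulr_sumr [RHS](reindex_inj rev_ord_inj) /=;
  apply: eq_bigr => j _.
have jM := ltn_ord j.
have e : q ^+ 'C(M.+1, 2) * q ^+ 'C(j, 2) = q ^+ 'C((M - j.+1).+2, 2) * t ^+ j.
  rewrite -exprM -!exprD; congr (_ ^+ _); move: (nat_of_ord j) jM => i iM.
  have -> : ((M - i.+1).+2 = (M - i).+1)%N by lia.
  have [m ->] : exists m, M = (i + m)%N by exists (M - i)%N; lia.
  rewrite addKn -addnS bin2D; have := bin2_sqr i; have := bin2S i; lia.
have s : (-1) ^+ M * (-1) ^+ j = (-1) ^+ (M - j.+1).+1 :> F.
  have -> : ((M - j.+1).+1 = M - j)%N by lia.
  move: (nat_of_ord j) jM => i iM.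
  by rewrite -[in LHS](subnK (ltnW iM)) exprD -mulrA -exprD addnn -mul2n exprM
    sqrrN !expr1n mulr1.
have -> : qbinom (M + M) (M + (M - j.+1).+1) = qbinom (M + M) j.
  by rewrite -[RHS]qbinom_sym; [congr (qbinom _ _); lia | lia].
have yy : w * x ^+ j = (-1) ^+ M * q ^+ 'C(M.+1, 2) * (y * y ^+ (M - j.+1)).
  rewrite /w -exprS (_ : y ^+ M = y ^+ (M - j.+1).+1 * y ^+ j).
    by rewrite -!mulrA -exprMn [y * x]mulrC xy expr1n mulr1.
  by rewrite -exprD; congr (_ ^+ _); lia.
have tt : t ^+ j != 0 by rewrite expf_neq0.
transitivity (w * x ^+ j * ((-1) ^+ j * q ^+ 'C(j, 2) * (t ^+ j)^-1 *
  qbinom (M + M) j)).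
  by rewrite exprMn exprVn; ring.
rewrite yy; transitivity (((-1) ^+ M * (-1) ^+ j) * (q ^+ 'C(M.+1, 2) * q ^+ 'C(j, 2)) *
    (t ^+ j)^-1 * (y * y ^+ (M - j.+1)) * qbinom (M + M) j); first by ring.
by rewrite s e; field.
Qed.
End FiniteTripleProduct.

Section ThetaZeros.
Local Open Scope classical_set_scope.
Local Open Scope complex_scope.
Context {R : realType} (tau : Cplx R).
Hypothesis tau_gt0 : 0 < complex.Im tau.
Notation C := (Cplx R).
Notation q := (nome tau).

(** A sequence of indices that lags behind the identity by at most a constant
    tends to infinity. *)
Lemma cvg_subseq (f : nat -> nat) (v : nat -> C) (l : C) i :
  (forall M, M <= f M + i)%N -> v @ \oo --> l -> v (f M) @[M --> \oo] --> l.
Proof.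
move=> fi vl; apply: (@cvg_comp _ _ _ f v \oo \oo) => //.
move=> A [N _ H]; exists (N + i)%N => // M /= NM; apply: H => /=.
by have := fi M; lia.
Qed.

Lemma lim_series_finite (u : nat -> C) N : (forall k, (N <= k)%N -> u k = 0) ->
  limn (series u) = \sum_(k < N) u k.
Proof.
move=> u0; apply: cvg_lim; first exact: norm_hausdorff.
apply/cvgrPdist_lt => e e0; exists N => // n /= Nn.
suff -> : series u n = \sum_(k < N) u k by rewrite subrr normr0.
rewrite seriesEnat /= (@big_cat_nat _ _ _ N)//= big_mkord [X in _ + X]big_nat_cond.
rewrite [X in _ + X]big1 ?addr0// => k /andP[/andP[Nk _] _]; exact: u0.
Qed.

Lemma is_cvg_series_geom (c : R) : cvgn (series (fun k => c * Normc.normc q ^+ k)).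
Proof.
have /andP[q0 q1] := normc_nome tau_gt0.
apply: (@is_cvg_geometric_series R c (Normc.normc q)).
by rewrite ger0_norm.
Qed.

Lemma nomeX_neq1 k : 1 - q ^+ k.+1 != 0.
Proof.
have /andP[q0 q1] := normc_nome tau_gt0.
rewrite subr_eq0; apply/eqP => h.
have : Normc.normc (q ^+ k.+1) < 1 by rewrite normcX exprn_ilt1.
by rewrite -h Normc.normc1 ltxx.
Qed.

(** A factor 1 - q^b x^a of the triple product, where a is 1 or - 1, vanishes at
    lattice points only, as the kernel of the exponential is 2 pi i Z. *)
Lemma lattice_cexp (a b : int) (z w : C) : w = b%:~R * tau + a%:~R * z -> a =
  1 \/ a = - 1 ->
  cexp (twopii * w) = 1 -> lattice tau z.
Proof.
move=> wE a1 /cexp_eq1[k hk].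
have wk : w = k%:~R.
  have t0 : (twopii : C) != 0.
    rewrite /twopii !mulf_neq0 ?pnatr_eq0//.
      by rewrite fmorph_eq0 gt_eqF// pi_gt0.
    by rewrite eq_complex /= oner_eq0 andbF.
  apply: (mulfI t0); rewrite hk /twopii rmorphM /= rmorph_int; ring.
case: a1 => aE; [exists k, (- b)|exists (- k), b].
  by rewrite -wk wE aE rmorphN /=; ring.
by rewrite intrN -wk wE aE !intrN; ring.
Qed.

Lemma cvgC_unique (f : nat -> C) (l l' : C) :
  f @ \oo --> l -> f @ \oo --> l' -> l = l'.
Proof. by move=> h h'; exact: (cvg_unique (@norm_hausdorff _ C) h h'). Qed.

(** Off the lattice no factor of the triple product vanishes, so the infinite
    products have nonzero limits l1 and l2. The q-binomial coefficients are
    bounded and tend to 1 / e, where e is the limit of (1 - q) ... (1 - q^k); hence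
    the finite triple product converges to l1 l2 = theta / e. *)
Lemma theta_zero_lattice z : theta tau z = 0 -> lattice tau z.
Proof.
move=> th0; apply: contrapT => nl.
have /andP[Q0 Q1] := normc_nome tau_gt0.
pose x : C := cexp (twopii * z); pose y : C := cexp (- (twopii * z)).
have xy : x * y = 1 by rewrite /x /y -cexpD subrr cexp0.
have q0 : q != 0 := cexp_neq0 _.
have x1 k : 1 - q ^+ k * x != 0.
  rewrite subr_eq0; apply/eqP => h; apply: nl.
  apply: (@lattice_cexp 1 k%:Z z (k%:R * tau + z)); [by rewrite mul1r|by left|].
  rewrite mulrDr cexpD [RHS]h; congr (_ * _).
  by rewrite /nome -cexpMn; congr cexp; ring.
have y1 k : 1 - q ^+ k.+1 * y != 0.
  rewrite subr_eq0; apply/eqP => h; apply: nl.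
  apply: (@lattice_cexp (-1) k.+1%:Z z (k.+1%:R * tau - z));
    [by rewrite mulN1r|by right|].
  rewrite mulrBr cexpD [RHS]h; congr (_ * _).
  by rewrite /nome -cexpMn; congr cexp; ring.
have geom (c : R) := @is_cvg_series_geom c.
have [l1 l10 c1] : exists2 l : C, l != 0 &
    (fun M : nat => \prod_(k < M) (1 - q ^+ k * x)) @ \oo --> l.
  apply: (@cvg_prodC_neq0 _ (fun k => q ^+ k * x) _ (geom (Normc.normc x))) => // k.
  by rewrite Normc.normcM normcX mulrC.
have [l2 l20 c2] : exists2 l : C, l != 0 &
    (fun M : nat => \prod_(k < M) (1 - q ^+ k.+1 * y)) @ \oo --> l.
  apply: (@cvg_prodC_neq0 _ (fun k => q ^+ k.+1 * y) _ (geom (Normc.normc y))) => // k.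
  rewrite Normc.normcM normcX mulrC ler_wpM2l ?normc_ge0//.
  by rewrite exprS ler_piMl ?exprn_ge0// ltW.
have [e e0 ce] : exists2 l : C, l != 0 & qpoch q @ \oo --> l.
  apply: (@cvg_prodC_neq0 _ (fun k => q ^+ k.+1) _ (geom 1)) => k;
    last exact: nomeX_neq1.
  by rewrite normcX mul1r exprS ler_piMl ?exprn_ge0// ltW.
have cb i : qbinom q (M + M) (M + i) @[M --> \oo] --> e^-1.
  have E : (qpoch q (M + M) / (qpoch q (M + i) * qpoch q (M - i))) @[M --> \oo]
    --> e / (e * e).
    apply: cvgM.
      by apply: (@cvg_subseq (fun M => M + M)%N _ _ 0) => // M; lia.
    apply: cvgV; first by rewrite mulf_neq0.
    apply: cvgM.
      by apply: (@cvg_subseq (fun M => M + i)%N _ _ 0) => // M; lia.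
    by apply: (@cvg_subseq (fun M => M - i)%N _ _ i) => // M; lia.
  rewrite -[X in _ --> X](_ : e / (e * e) = _); last by field.
  apply: cvg_trans E; apply: near_eq_cvg.
  near=> M.
  have iM : (i <= M)%N by near: M; exists i.
  rewrite /qbinom leq_add2l iM; congr (_ / (_ * qpoch _ _)); lia.
have [D1 HD1] := cvgC_bounded ce.
have [D2 HD2] : exists D, forall k, Normc.normc (qpoch q k)^-1 <= D.
  by apply: cvgC_bounded (e^-1) _; apply: cvgV.
pose D := D1 * (D2 * D2).
have bD M i : Normc.normc (qbinom q (M + M) i) <= D.
  have D10 : 0 <= D1 := le_trans (normc_ge0 _) (HD1 0%N).
  have D20 : 0 <= D2 := le_trans (normc_ge0 _) (HD2 0%N).
  rewrite /qbinom; case: ifP => _; last first.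
    by rewrite Normc.normc0 !mulr_ge0.
  rewrite invfM !Normc.normcM; apply: ler_pM => //; rewrite ?mulr_ge0 ?normc_ge0//.
  by apply: ler_pM; rewrite ?normc_ge0.
have lim_side (u : nat -> C) (w : C) (s : nat -> nat) : entire_coefs u ->
  limn (series (fun k => u k * w ^+ k * qbinom q (M + M) (M + s k))) @[M --> \oo]
    --> e^-1 * pseriesC u w.
  move=> eu; have cw := is_cvg_pseriesC (x := w) eu.
  have -> : e^-1 * pseriesC u w = limn (series (e^-1 *: (fun k => u k * w ^+ k))).
    exact: esym (lim_seriesZ e^-1 cw).
  apply: (@tannery _ _ _ _ _ _ (D *: (fun k => Normc.normc (u k) *
    Normc.normc w ^+ k))).
  - by apply: is_cvg_seriesZ; exact: eu (normc_ge0 w).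
  - apply: nearW => M k.
    rewrite [leLHS]Normc.normcM [leLHS]mulrC Normc.normcM normcX.
    by apply: ler_pM; rewrite ?mulr_ge0 ?exprn_ge0 ?normc_ge0.
  - move=> k; rewrite [X in _ --> X]mulrC; apply: cvgMr; exact: cb.
pose P1 (M : nat) : C := \prod_(k < M) (1 - q ^+ k * x).
pose P2 (M : nat) : C := \prod_(k < M) (1 - q ^+ k.+1 * y).
have cL : P1 * P2 @ \oo --> l1 * l2 by exact: (cvgM c1 c2).
have cR : P1 * P2 @ \oo -->
    e^-1 * pseriesC (theta_pos tau) x + y * (e^-1 * pseriesC (theta_neg tau) y).
  pose S1 (M : nat) : C :=
    limn (series (fun k => theta_pos tau k * x ^+ k * qbinom q (M + M) (M + k))).
  pose S2 (M : nat) : C :=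
    limn (series (fun k => theta_neg tau k * y ^+ k * qbinom q (M + M) (M + k.+1))).
  have c1' : S1 @ \oo --> e^-1 * pseriesC (theta_pos tau) x.
    exact: (lim_side _ _ id (entire_theta_pos tau_gt0)).
  have c2' : S2 @ \oo --> e^-1 * pseriesC (theta_neg tau) y.
    exact: (lim_side _ _ S (entire_theta_neg tau_gt0)).
  have -> : P1 * P2 = S1 + cst y * S2.
    apply/funext => M; apply: etrans (finite_triple_product nomeX_neq1 M q0 xy) _.
    congr (_ + _ * _); symmetry; apply: lim_series_finite => k kM.
      by rewrite qbinom_small ?mulr0//; lia.
    by rewrite qbinom_small ?mulr0//; lia.
  exact: (cvgD c1' (cvgM (@cvg_cst _ y _ \oo _) c2')).
have E : l1 * l2 = e^-1 * pseriesC (theta_pos tau) x + y *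
  (e^-1 * pseriesC (theta_neg tau) y).
  exact: (cvgC_unique cL cR).
have {}E : l1 * l2 = e^-1 * theta tau z.
  by rewrite E [y * (_ * _)]mulrCA -mulrDr (thetaE tau_gt0 z).
by move/eqP: E; rewrite th0 mulr0 mulf_eq0 (negPf l10) (negPf l20).
Unshelve. all: by end_near. Qed.
End ThetaZeros.

(** * The star product as a sum over subsets *)

Section StarAsSubsets.
Context {R : realType} (n : nat) (tau eta : Cplx R).
Notation C := (Cplx R).

(** Points given by lists, so that a symmetric function may be applied to any
    enumeration of a set of coordinates. *)
Definition rowseq a (s : seq C) : 'rV[C]_a := \row_(i < a) s`_i.

Definition symmetric_fun a (f : 'rV[C]_a -> C) : Prop :=
  forall (s : 'S_a) z, f (col_perm s z) = f z.

Lemma symmetric_rowseq a (f : 'rV[C]_a -> C) (s s' : seq C) :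
  symmetric_fun f -> size s' = a -> perm_eq s s' -> f (rowseq a s) = f (rowseq a s').
Proof.
move=> fs /eqP sa /(@tuple_permP _ _ s (Tuple sa))[p ->].
rewrite -(fs p (rowseq a s')); congr f; apply/rowP => i.
by rewrite !mxE -tnth_nth tnth_mktuple (tnth_nth 0).
Qed.

Lemma rowseq_codom a (z : 'I_a -> C) : \row_i z i = rowseq a (map z (enum 'I_a)).
Proof.
apply/rowP => i; rewrite !mxE (nth_map i) ?size_enum_ord//.
by rewrite nth_ord_enum.
Qed.

Definition theta_quotient (z : C) : C := theta tau (z - n%:R * eta) / theta tau z.

Definition subset_term a b (f : 'rV[C]_a -> C) (g : 'rV[C]_b -> C) (d : nat)
    (z : 'I_d -> C) (S : {set 'I_d}) : C :=
  f (rowseq a [seq z i | i <- enum S]) *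
  g (rowseq b [seq z i - 2 * a%:R * eta | i <- enum (~: S)]) *
  \prod_(i in S) \prod_(j in ~: S) theta_quotient (z i - z j).

(** By symmetry of f and g the summand depends only on the image S of the first a
    positions; each S arises from a! b! permutations, which cancels the
    prefactor. *)
Lemma star_formula_subsets a b (f : 'rV[C]_a -> C) (g : 'rV[C]_b -> C)
    (z : 'rV[C]_(a + b)) : symmetric_fun f -> symmetric_fun g ->
  star_formula n tau eta f g z =
  \sum_(S : {set 'I_(a + b)} | #|S| == a) subset_term f g (z 0) S.
Proof.
move=> fs gs; pose L := [set lshift b i | i : 'I_a].
have cL : #|L| = a by rewrite card_imset ?card_ord//; exact: lshift_inj.
have LC : ~: L = [set rshift a j | j : 'I_b].
  apply/setP => x; rewrite inE; case: (split_ordP x) => j ->.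
    rewrite imset_f//=; apply/esym/imsetP => -[k _ /eqP].
    by rewrite eq_lrshift.
  by rewrite imset_f//; apply/imsetP => -[k _ /eqP]; rewrite eq_rlshift.
have cLC : #|~: L| = b by rewrite LC card_imset ?card_ord//; exact: rshift_inj.
have termE (s : 'S_(a + b)) :
  f (\row_i z 0 (s (lshift b i))) * g (\row_j (z 0 (s (rshift a j)) - 2 * a%:R * eta)) *
  \prod_(i < a) \prod_(j < b)
    (theta tau (z 0 (s (lshift b i)) - z 0 (s (rshift a j)) - n%:R * eta) /
     theta tau (z 0 (s (lshift b i)) - z 0 (s (rshift a j)))) =
  subset_term f g (z 0) (s @: L).
  have sC : ~: (s @: L) = s @: (~: L).
    apply/setP => x; rewrite -[x](permKV s) inE.
    by rewrite !(mem_imset _ _ (@perm_inj _ s)) inE.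
  have eL : perm_eq [seq s (lshift b i) | i <- enum 'I_a] (enum (s @: L)).
    apply: uniq_perm; [|exact: enum_uniq|].
      by rewrite map_inj_uniq ?enum_uniq// => i j /perm_inj/lshift_inj.
    move=> x; rewrite mem_enum -imset_comp; apply/mapP/imsetP => -[i _ ->];
      by exists i; rewrite ?mem_enum.
  have eR : perm_eq [seq s (rshift a j) | j <- enum 'I_b] (enum (~: (s @: L))).
    apply: uniq_perm; [|exact: enum_uniq|].
      by rewrite map_inj_uniq ?enum_uniq// => i j /perm_inj/rshift_inj.
    move=> x; rewrite mem_enum sC LC -imset_comp; apply/mapP/imsetP => -[i _ ->];
      by exists i; rewrite ?mem_enum.
  rewrite /subset_term; congr (_ * _ * _).
  - rewrite rowseq_codom; apply: symmetric_rowseq => //.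
      by rewrite size_map -cardE card_imset ?cL//; exact: perm_inj.
    by rewrite (map_comp (z 0) (fun i => s (lshift b i))); exact: perm_map.
  - rewrite rowseq_codom; apply: symmetric_rowseq => //.
      by rewrite size_map -cardE sC card_imset ?cLC//; exact: perm_inj.
    by rewrite (map_comp (fun x => z 0 x - 2 * a%:R * eta) (fun i => s (rshift a i)));
      exact: perm_map.
  - rewrite -[RHS]big_enum -(perm_big _ eL) big_map big_enum /=.
    apply: eq_bigr => i _; rewrite -[RHS]big_enum -(perm_big _ eR) big_map big_enum /=.
    by apply: eq_bigr => j _.
rewrite /star_formula; under eq_bigr do rewrite termE.
rewrite (sum_perm_imset L (subset_term f g (z 0))) cL cLC sumrMnl
  -[(\sum_(S | _) _) *+ _]mulr_natl natrM mulKf//.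
Qed.
End StarAsSubsets.

(** * The kernel of the homomorphism *)

Section Kernel.
Context {R : realType} (n p : nat) (tau eta : Cplx R).
Hypothesis tau_gt0 : 0 < complex.Im tau.
Notation C := (Cplx R).
Notation V := 'rV[C]_p.
Notation multinom := (mpoly.multinom p).
Notation mdeg := mpoly.mdeg.
Notation step := (n%:R * eta).
Notation shift m := (Bmon_shift eta n m).
Implicit Types (u : V) (m : multinom).

Definition point u (x : 'I_p * nat) : C := u 0 x.1 + x.2%:R * step.

Definition points m u : seq C := [seq point u x | x <- boxes m].

(** The values of theta from which both the kernel and the star product at the
    points of the boxes are made. *)
Definition theta_diff u (i j : 'I_p) (r : int) : C :=
  theta tau (u 0 i - u 0 j + r%:~R * step).

(** The factors with i = j are constants; for the generators they are cancelled
    by the power of theta (- step) in the kernel. *)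
Definition kernel_den m u : C :=
  \prod_(i < p) \prod_(j < p) \prod_(k < m i) theta_diff u i j (k%:Z - (m j)%:Z).

Definition kernel m u : C := theta tau (- step) ^+ mdeg m / kernel_den m u.

(** No two of the points of at most d boxes differ by a zero of theta, and the
    factors of the denominators of the kernels do not vanish. *)
Definition regular (d : nat) u : Prop := forall i j (r : int),
  (i != j) || (r != 0) -> (`|r| <= d)%N -> theta_diff u i j r != 0.

Lemma size_points m u : size (points m u) = mdeg m.
Proof. by rewrite size_map size_boxes. Qed.

Lemma point_sub u x y :
  point u x - point u y = u 0 x.1 - u 0 y.1 + (x.2%:Z - y.2%:Z)%:~R * step.
Proof. by rewrite /point intrB -!pmulrn; ring. Qed.

Lemma Bmon_shiftE m i : shift m 0 i = (n%:R * (m i)%:R - 2 * (mdeg m)%:R) * eta.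
Proof.
rewrite /Bmon_shift summxE mpoly.mdegE natr_sum.
rewrite mulr_sumr (bigD1 i)//= [X in _ - X](bigD1 i)//=.
rewrite opprD addrA mulrDl -sumrN mulr_suml; congr (_ + _).
  by rewrite mulmxnE !mxE eqxx -mulr_natr; ring.
apply: eq_bigr => j ji; rewrite mulmxnE !mxE eq_sym (negPf ji) -mulr_natr; ring.
Qed.

(** The translation by which e^m acts lifts the boxes above those of m, up to the
    translation by - 2 (mdeg m) eta that occurs in the star product. *)
Lemma point_shift m u x :
  point (u + shift m) x = point u (x.1, m x.1 + x.2)%N - 2 * (mdeg m)%:R * eta.
Proof. by rewrite /point mxE Bmon_shiftE /= natrD; ring. Qed.

Lemma theta_diff_shift m u i j r :
  theta_diff (u + shift m) i j r = theta_diff u i j ((m i)%:Z - (m j)%:Z + r).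
Proof.
rewrite /theta_diff !mxE !Bmon_shiftE !(intrD, intrN) -!pmulrn; congr theta; ring.
Qed.

Lemma le_mdeg m i : (m i <= mdeg m)%N.
Proof. by rewrite mpoly.mdegE (bigD1 i)//= leq_addr. Qed.

Lemma prod_lower_upper m m' (F : 'I_p * nat -> 'I_p * nat -> C) : le_multinom m m' ->
  \prod_(t in lower m m') \prod_(s in ~: lower m m') F (label t) (label s) =
  \prod_(i < p) \prod_(j < p) \prod_(k < m' i) \prod_(l < m j - m' j)
     F (i, val k) (j, m' j + l)%N.
Proof.
move=> m'm.
transitivity (\prod_(x <- boxes m') \prod_(y <- boxes (mpoly.mnm_sub m m')) F x
  (y.1, m' y.1 + y.2)%N).
  rewrite -(perm_big _ (perm_lower m'm)) big_map big_enum /=; apply: eq_bigr => t _.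
  by rewrite -[RHS](big_map (fun y => (y.1, m' y.1 + y.2)%N) xpredT)
    -(perm_big _ (perm_upper m'm)) big_map big_enum.
rewrite big_boxes; apply: eq_bigr => i _.
under eq_bigr do rewrite big_boxes.
rewrite exchange_big /=; apply: eq_bigr => j _; apply: eq_bigr => k _.
by rewrite mpoly.mnmBE.
Qed.

Lemma theta_quotient_points u i j (k l : nat) :
  theta_quotient n tau eta (point u (i, k) - point u (j, l)) =
  theta_diff u i j (k%:Z - l.+1%:Z) / theta_diff u i j (k%:Z - l%:Z).
Proof.
rewrite /theta_quotient point_sub /theta_diff; congr (theta tau _ / _).
by rewrite /= !intrB -!pmulrn -natr1; ring.
Qed.

Lemma mdeg_sub m m' : le_multinom m m' ->
  (mdeg m' + mdeg (mpoly.mnm_sub m m'))%N = mdeg m.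
Proof.
move=> m'm; rewrite !mpoly.mdegE -big_split; apply: eq_bigr => i _.
by rewrite mpoly.mnmBE /= subnKC.
Qed.

(** For fixed columns i and j and a fixed box k of m' the quotients telescope over
    the boxes of column j outside m'. What remains is the part k < m' i of the
    denominator for m, divided by the denominator for m'; the part k >= m' i of
    the denominator for m is the shifted denominator for m - m'. *)
Lemma kernel_cocycle m m' u : le_multinom m m' -> regular (mdeg m) u ->
  kernel m u * \prod_(t in lower m m') \prod_(s in ~: lower m m')
     theta_quotient n tau eta (point u (label t) - point u (label s)) =
  kernel m' u * kernel (mpoly.mnm_sub m m') (u + shift m').
Proof.
move=> m'm ru.
have mE i : m i = (m' i + mpoly.mnm_sub m m' i)%N by rewrite mpoly.mnmBE subnKC.
set m'' := mpoly.mnm_sub m m' in mE *.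
have mdE : mdeg m = (mdeg m' + mdeg m'')%N.
  by rewrite mdeg_sub.
rewrite (@prod_lower_upper _ _ (fun x y => theta_quotient n tau eta
  (point u x - point u y)))//.
(* For i = j regularity asks that k and l differ; k < l holds wherever nz is used. *)
have nz i j (k l : nat) : (k < m i)%N -> (k < l)%N || (i != j) -> (l <= m j)%N ->
    theta_diff u i j (k%:Z - l%:Z) != 0.
  move=> km kl lm; apply: ru.
    by case: (i != j) kl => //=; lia.
  have [e|ij] := eqVneq i j.
    by subst j; have := le_mdeg m i; lia.
  have : (m i + m j <= mdeg m)%N.
    by rewrite mpoly.mdegE (bigD1 i)//= (bigD1 j) 1?eq_sym//= addnA leq_addr.
  lia.
have inner i j (k : nat) : (k < m' i)%N ->
    \prod_(l < m j - m' j) theta_quotient n tau eta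
      (point u (i, k) - point u (j, m' j + l)%N) =
    theta_diff u i j (k%:Z - (m j)%:Z) / theta_diff u i j (k%:Z - (m' j)%:Z).
  move=> km; have km2 : (k < m i)%N by apply: leq_trans km (m'm i).
  have kl l : (k < m' j + l)%N || (i != j).
    have [e|ne] := eqVneq i j; last by rewrite orbT.
    by subst j; rewrite (leq_trans km (leq_addr _ _)).
  have tel l : (l <= m j - m' j)%N ->
      \prod_(r < l) theta_quotient n tau eta
        (point u (i, k) - point u (j, m' j + r)%N) =
      theta_diff u i j (k%:Z - (m' j + l)%N%:Z) / theta_diff u i j (k%:Z - (m' j)%:Z).
    elim: l => [|l IH] lb.
      rewrite big_ord0 addn0 divff//; apply: nz => //.
      by have := kl 0%N; rewrite addn0.
    rewrite big_ord_recr /= IH; last exact: ltnW.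
    rewrite theta_quotient_points addnS mulrC mulrA divfK //.
    apply: nz => //; have := m'm j; lia.
  by rewrite tel// subnKC.
suff E : (kernel_den m u)^-1 * \prod_(i < p) \prod_(j < p) \prod_(k < m' i)
     \prod_(l < m j - m' j) theta_quotient n tau eta
       (point u (i, val k) - point u (j, m' j + l)%N) =
     (kernel_den m' u)^-1 * (kernel_den m'' (u + shift m'))^-1.
  by rewrite /kernel mdE exprD -mulrA E; ring.
rewrite /kernel_den -!prodfV -!big_split /=; apply: eq_bigr => i _.
rewrite -!prodfV -!big_split /=; apply: eq_bigr => j _.
under [X in _ * X = _]eq_bigr do rewrite inner//.
rewrite prodf_div [in LHS]mE big_split_ord /=.
under [X in _ = _ / X]eq_bigr do rewrite theta_diff_shift.
have -> : \prod_(k < m'' i) theta_diff u i j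
  ((m' i)%:Z - (m' j)%:Z + (k%:Z - (m'' j)%:Z)) =
  \prod_(k < m'' i) theta_diff u i j ((m' i + k)%N%:Z - (m j)%:Z).
  by apply: eq_bigr => k _; congr theta_diff; rewrite mE !PoszD; ring.
have h : \prod_(k < m' i) theta_diff u i j (k%:Z - (m j)%:Z) != 0.
  rewrite prodf_seq_neq0; apply/allP => k _ /=.
  have km := ltn_ord k.
  apply: nz => //; first exact: leq_trans km (m'm i).
  have [e|ne] := eqVneq i j; last by rewrite orbT.
  by subst j; rewrite (leq_trans km (m'm i)).
by rewrite invfM mulrACA mulVf// mul1r mulrC.
Qed.

(** A box in S just above a box outside S contributes the factor theta 0. *)
Lemma prod_theta_quotient_eq0 m u (S : {set 'I_(mdeg m)}) : ~ down_closed S ->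
  \prod_(t in S) \prod_(s in ~: S)
     theta_quotient n tau eta (point u (label t) - point u (label s)) = 0.
Proof.
move=> nS; apply/eqP; apply: contra_notT nS => P0 t t' tS e1 e2.
apply/negPn/negP => t'S; move/negP: P0; apply; apply/eqP.
rewrite (bigD1 t)//= (bigD1 t') ?inE//=.
have -> : label t = ((label t').1, (label t').2.+1) by rewrite -e1 -e2; case: (label t).
have -> : label t' = ((label t').1, (label t').2) by case: (label t').
rewrite theta_quotient_points /theta_diff !subrr mul0r addr0.
by rewrite (theta0 tau_gt0) !mul0r.
Qed.

(** By point_shift, translating u by the shift of m' accounts both for the lower
    ends of the columns that remain and for the translation of the arguments
    of the second factor of a star product. *)
Lemma shift_points m m' u : le_multinom m m' ->
  perm_eq [seq point u (label t) - 2 * (mdeg m')%:R * eta | t <- enum (~: lower m m')]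
          (points (mpoly.mnm_sub m m') (u + shift m')).
Proof.
move=> m'm; rewrite (map_comp (fun x => point u x - 2 * (mdeg m')%:R *
  eta) (@label _ m)).
rewrite (perm_trans (perm_map _ (perm_upper m'm)))// -map_comp.
by rewrite /points; under [X in perm_eq _ X]eq_map do rewrite point_shift.
Qed.

(** Multiplicativity of the homomorphism, before the limit in the definition of
    the star product and the passage to germs. *)
Lemma star_formula_points a b (f : 'rV[C]_a -> C) (g : 'rV[C]_b -> C) m u
    (e : mdeg m = (a + b)%N) : symmetric_fun f -> symmetric_fun g ->
  regular (mdeg m) u ->
  star_formula n tau eta f g (rowseq (a + b) (points m u)) * kernel m u =
  \sum_(m' : mpoly.bmultinom p (mdeg m).+1 | [forall i, mpoly.bmnm m' i <= m i]%N &&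
     (mdeg (mpoly.bmnm m') == a))
   (f (rowseq a (points (mpoly.bmnm m') u)) * kernel (mpoly.bmnm m') u) *
   (g (rowseq b (points (mpoly.mnm_sub m (mpoly.bmnm m'))
     (u + shift (mpoly.bmnm m')))) *
    kernel (mpoly.mnm_sub m (mpoly.bmnm m')) (u + shift (mpoly.bmnm m'))).
Proof.
move=> fs gs ru; rewrite star_formula_subsets//.
have -> : \sum_(S : {set 'I_(a + b)} | #|S| == a)
    subset_term n tau eta f g (rowseq (a + b) (points m u) 0) S =
  \sum_(S : {set 'I_(mdeg m)} | #|S| == a)
    subset_term n tau eta f g (fun t => point u (label t)) S.
  have pE (t : 'I_(mdeg m)) : rowseq (mdeg m) (points m u) 0 t = point u (label t).
    rewrite mxE (nth_map (label t)) ?size_boxes ?ltn_ord//.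
    by congr point; rewrite [in RHS]/label (tnth_nth (label t)).
  rewrite -(funext pE); move: (points m u) => w {ru pE}.
  by move: (mdeg m) e => d ->.
rewrite sum_down_closed; last first.
  by move=> S /(@prod_theta_quotient_eq0 _ u) P0; rewrite /subset_term P0 mulr0.
rewrite mulr_suml; apply: eq_bigr => m' /andP[/fintype.forallP m'm /eqP m'a].
rewrite [RHS]mulrACA -(kernel_cocycle m'm ru) /subset_term.
have -> : rowseq a [seq point u (label t) | t <- enum (lower m m')] =
    rowseq a (map (point u) (map (@label _ m) (enum (lower m m')))) by
      rewrite -map_comp.
rewrite (symmetric_rowseq fs _ (perm_map _ (perm_lower m'm))); last first.
  by rewrite size_map size_boxes.
have sp := shift_points u m'm; rewrite m'a in sp.
rewrite (symmetric_rowseq gs _ sp); last first.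
  by rewrite size_points; have := mdeg_sub m'm; lia.
by rewrite -/(points m' u); ring.
Qed.
End Kernel.

Local Open Scope classical_set_scope.

(** * The star product off the poles *)

Section Holomorphy.
Context {R : realType}.
Notation C := (Cplx R).

(** A row is the sum of its coordinates times the basis vectors. *)
Lemma differentiable_row (V : normedModType C) d (F : 'I_d -> V -> C) (v : V) :
  (forall t, differentiable (F t) v) ->
  differentiable (fun v => \row_t F t v : 'rV[C]_d) v.
Proof.
move=> dF.
have -> : (fun v => \row_t F t v : 'rV[C]_d) =
  \sum_(t < d) (fun v => F t v *: (delta_mx 0 t : 'rV[C]_d)).
  apply/funext => w; rewrite fct_sumE; apply/rowP => j.
  rewrite summxE (bigD1 j)//= !mxE !eqxx mulr1 big1 ?addr0// => t tj.
  by rewrite !mxE eq_sym (negPf tj) andbF mulr0.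
by apply: differentiable_sum => t; exact: differentiableZl.
Qed.

Lemma differentiable_prod (V : normedModType C) (I : Type) (s : seq I) (P : pred I)
    (F : I -> V -> C) (v : V) : (forall i, P i -> differentiable (F i) v) ->
  differentiable (fun v => \prod_(i <- s | P i) F i v) v.
Proof.
move=> dF; elim: s => [|i s IH].
  by under eq_fun do rewrite big_nil; exact: differentiable_cst.
under eq_fun do rewrite big_cons.
case: (boolP (P i)) => Pi; last exact: IH.
exact: (differentiableM (dF i Pi) IH).
Qed.

Lemma differentiable_fsum (V : normedModType C) (I : Type) (s : seq I) (P : pred I)
    (F : I -> V -> C) (v : V) : (forall i, P i -> differentiable (F i) v) ->
  differentiable (fun v => \sum_(i <- s | P i) F i v) v.
Proof.
move=> dF; elim: s => [|i s IH].
  by under eq_fun do rewrite big_nil; exact: differentiable_cst.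
under eq_fun do rewrite big_cons.
case: (boolP (P i)) => Pi; last exact: IH.
exact: (differentiableD (dF i Pi) IH).
Qed.

Lemma differentiable_sub_cst d (i j : 'I_d) (k : C) (v : 'rV[C]_d) :
  differentiable (fun v : 'rV[C]_d => v 0 i - v 0 j + k) v.
Proof.
apply: differentiableD; last exact: differentiable_cst.
apply: differentiableB; exact: differentiable_coord.
Qed.

End Holomorphy.

Section StarOnDomain.
Context {R : realType} (n : nat) (tau eta : Cplx R).
Hypothesis tau_gt0 : 0 < complex.Im tau.
Notation C := (Cplx R).

Lemma differentiable_star_formula a b (f : 'rV[C]_a -> C) (g : 'rV[C]_b -> C)
    (z : 'rV[C]_(a + b)) :
  (forall w, differentiable f w) -> (forall w, differentiable g w) ->
  star_domain tau z -> differentiable (star_formula n tau eta f g) z.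
Proof.
move=> df dg zD.
apply: differentiableM; first exact: differentiable_cst.
apply: differentiable_fsum => s _; apply: differentiableM; first apply: differentiableM.
- have h : differentiable (fun z : 'rV[C]_(a + b) => \row_i z 0
  (s (lshift b i)) : 'rV[C]_a) z.
    by apply: differentiable_row => t; exact: differentiable_coord.
  exact: (differentiable_comp h (df _)).
- have h : differentiable (fun z : 'rV[C]_(a + b) => \row_j (z 0 (s (rshift a j)) - 2 *
  a%:R * eta) : 'rV[C]_b) z.
    apply: differentiable_row => t; apply: differentiableB;
      first exact: differentiable_coord.
    exact: differentiable_cst.
  exact: (differentiable_comp h (dg _)).
- apply: differentiable_prod => i _; apply: differentiable_prod => j _.
  have ne : s (lshift b i) != s (rshift a j) by rewrite (inj_eq perm_inj) eq_lrshift.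
  apply: differentiableM.
    exact: (differentiable_comp (differentiable_sub_cst _ _ (- (n%:R * eta)) z)
      (differentiable_theta tau_gt0 _)).
  apply: differentiableV; last exact: zD.
  have h := differentiable_comp (differentiable_sub_cst (s (lshift b i))
    (s (rshift a j)) 0 z) (differentiable_theta tau_gt0 _).
  by move: h; rewrite /comp; under eq_fun do rewrite addr0.
Qed.

(** The formula is holomorphic, hence continuous, at the points of its domain, so
    the limit that defines the star product is its value. *)
Lemma starE a b (f : 'rV[C]_a -> C) (g : 'rV[C]_b -> C) (z : 'rV[C]_(a + b)) :
  (forall w, differentiable f w) -> (forall w, differentiable g w) ->
  star_domain tau z -> star n tau eta f g z = star_formula n tau eta f g z.
Proof.
move=> df dg zD; rewrite /star.
have h : star_formula n tau eta f g w @[w --> z] --> star_formula n tau eta f g z.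
  exact: (differentiable_continuous (differentiable_star_formula df dg zD)).
have PF : ProperFilter (within (star_domain tau (m := a + b)) (nbhs z)).
  apply: within_nbhs_proper; exact: subset_closure.
apply: cvg_lim; first exact: norm_hausdorff.
apply: cvg_trans h; apply: cvg_app; exact: cvg_within.
Qed.
End StarOnDomain.

(** * Skew polynomials and germs of meromorphic functions *)

Section SkewCoefficients.
Variables (M : comNzRingType) (p : nat).
Variable s : mpoly.multinom p -> {rmorphism M -> M}.
Notation mcoeff := mpoly.mcoeff.
Notation mdeg := mpoly.mdeg.

Lemma mdeg_le (a m : mpoly.multinom p) : le_multinom m a -> (mdeg a < (mdeg m).+1)%N.
Proof. by move=> am; rewrite ltnS !mpoly.mdegE; apply: leq_sum => i _; exact: am. Qed.

Lemma subm_add (a m : mpoly.multinom p) : le_multinom m a ->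
  mpoly.mnm_add a (mpoly.mnm_sub m a) = m.
Proof.
by move=> am; apply/mpoly.mnmP => i; rewrite mpoly.mnmDE mpoly.mnmBE subnKC.
Qed.

Lemma mcoeff_Xmul (a m : mpoly.multinom p) (y : mpoly.mpoly p M) :
  mcoeff m (mpoly.mpolyX M a * y) =
  if [forall i, a i <= m i]%N then mcoeff (mpoly.mnm_sub m a) y else 0.
Proof.
rewrite mulrC; case: ifPn => [/fintype.forallP am|nam].
  by rewrite -{1}(subm_add am) mpoly.mcoeffMX.
rewrite [y]mpoly.mpolyE mulr_suml raddf_sum /= big1// => k _.
rewrite -scalerAl -mpoly.mpolyXD mpoly.mcoeffZ mpoly.mcoeffX.
case: eqP => [e|]; last by rewrite mulr0.
case/negP: nam; apply/fintype.forallP => i.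
by rewrite -e mpoly.mnmDE leq_addl.
Qed.

(** The sum runs over the bounded exponents because the support of x is not
    related to m. *)
Lemma mcoeff_skew_mul (x y : mpoly.mpoly p M) (m : mpoly.multinom p) :
  mcoeff m (skew_mul s x y) =
  \sum_(m' : mpoly.bmultinom p (mdeg m).+1 | [forall i, mpoly.bmnm m' i <= m i]%N)
    mcoeff (mpoly.bmnm m') x * s (mpoly.bmnm m')
      (mcoeff (mpoly.mnm_sub m (mpoly.bmnm m')) y).
Proof.
elim/mpoly.mpolyind: x => [|c a x _ _ IH].
  rewrite skew_mul0l mpoly.mcoeff0 big1// => m' _.
  by rewrite mpoly.mcoeff0 mul0r.
rewrite skew_mulDl mpoly.mcoeffD IH.
under [RHS]eq_bigr do rewrite mpoly.mcoeffD mulrDl.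
rewrite big_split /=; congr (_ + _).
rewrite skew_mul_mono mpoly.mcoeffZ mcoeff_Xmul mpoly.mcoeff_map_mpoly.
under [RHS]eq_bigr do rewrite mpoly.mcoeffZ mpoly.mcoeffX.
case: ifPn => [/fintype.forallP am|nam].
  rewrite (bigD1 (mpoly.BMultinom (mdeg_le am))) /=; last exact/fintype.forallP.
  rewrite eqxx mulr1 big1 ?addr0// => m' /andP[_ m'a].
  case: eqP => [e|_]; last by rewrite mulr0 mul0r.
  by case/eqP: m'a; apply/val_inj.
rewrite mulr0 big1// => m' m'm.
case: eqP => [e|_]; last by rewrite mulr0 mul0r.
by rewrite e m'm in nam.
Qed.
End SkewCoefficients.

Section Genericity.
Context {R : realType} (p : nat).
Notation C := (Cplx R).
Notation V := 'rV[C]_p.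

(** The condition on denominators of meromorphic functions, at every point. *)
Definition nonzero_dense (h : V -> C) : Prop :=
  forall w, closure [set v | h v != 0] w.

Lemma nonzero_dense_prod (I : Type) (s : seq I) (P : pred I) (F : I -> V -> C) :
  (forall i, P i -> (forall v, differentiable (F i) v) /\ nonzero_dense (F i)) ->
  nonzero_dense (fun v => \prod_(i <- s | P i) F i v).
Proof.
move=> dF; elim: s => [|i s IH].
  by move=> w; apply: subset_closure => /=; rewrite big_nil oner_neq0.
have [Pi|nPi] := boolP (P i); last first.
  by move=> w; under eq_set do rewrite big_cons (negPf nPi); exact: IH.
move=> w; under eq_set do rewrite big_cons Pi.
have [d nz] := dF i Pi.
apply: (nbhs_singleton (@closure_neq0M R p (F i)
  (fun v => \prod_(i <- s | P i) F i v) w _ _ _)).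
- by near=> v; exact: d.
- by near=> v; exact: nz.
- by near=> v; exact: IH.
Unshelve. all: by end_near. Qed.

Lemma open_neq0C (h : V -> C) : (forall v, differentiable h v) ->
  open [set v | h v != 0].
Proof.
move=> dh; apply: (@open_comp _ _ h [set x | x != 0]).
  by move=> v _; exact: differentiable_continuous.
rewrite [X in open X](_ : _ = ~` [set 0]); last by apply/seteqP; split => x /eqP.
apply: closed_openC; apply: accessible_closed_set1.
by apply: hausdorff_accessible; exact: norm_hausdorff.
Qed.

Lemma dense_generic (h : V -> C) (P : V -> Prop) :
  (forall v, differentiable h v) -> nonzero_dense h ->
  (forall v, h v != 0 -> P v) -> dense ([set v | P v]^°).
Proof.
move=> dh nh hP O [x Ox] oO.
have [v [hv Ov]] := nh x O (open_nbhs_nbhs (conj oO Ox)).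
exists v; split => //.
have : nbhs v [set v | h v != 0] by apply: open_nbhs_nbhs; split => //;
  exact: open_neq0C.
by apply: filterS => w; exact: hP.
Qed.

Lemma meromorphic_quotient (g h : V -> C) : (forall v, differentiable g v) ->
  (forall v, differentiable h v) -> nonzero_dense h ->
  meromorphic (fun v => g v / h v).
Proof.
move=> dg dh nh z; exists g, h; near=> w; split => //; exact: nh.
Unshelve. all: by end_near. Qed.

(** The meromorphic function that agrees with F on a dense open set. With this the
    coefficients of phi make sense for functions known at generic points only,
    such as star products. *)
Definition germ (F : V -> C) : mero R p :=
  if pselect (exists g : merofun p, dense ([set z | F z = (g : V -> C) z]^°)) is left e
  then \pi_(mero R p)%qT (projT1 (cid e)) else 0.

Lemma germE (F : V -> C) (g : merofun p) :
  dense ([set z | F z = (g : V -> C) z]^°) -> germ F = \pi_(mero R p)%qT g.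
Proof.
move=> Fg; rewrite /germ; case: pselect => [e|]; last by case; exists g.
case: (cid e) => g' /= Fg'; apply/eqP/mero_eqP => O Oo oO.
have [z [Oz [z1 z2]]] := denseI (open_interior _) Fg Fg' Oo oO.
exists z; split => //; apply: filterS (filterI z1 z2) => w [/= <- <-] //.
Qed.

Lemma germ_merofun (g : merofun p) : germ g = \pi_(mero R p)%qT g.
Proof.
apply: germE; rewrite (_ : [set z | _] = setT) ?interiorT; last exact/seteqP.
by move=> A A0 _; rewrite setIT.
Qed.

Lemma merofun_sumE (I : Type) (s : seq I) (P : pred I) (F : I -> merofun p) (u : V) :
  ((\sum_(i <- s | P i) F i : merofun p) : V -> C) u = \sum_(i <- s | P i)
    (F i : V -> C) u.
Proof. by apply: (big_morph (fun f : merofun p => (f : V -> C) u)). Qed.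

End Genericity.

(** * Generic points *)

Section Generic.
Context {R : realType} (n p : nat) (tau eta : Cplx R).
Hypotheses (n_gt0 : (0 < n)%N) (tau_gt0 : 0 < complex.Im tau).
Hypothesis eta_inf : infinite_order tau eta.
Notation C := (Cplx R).
Notation V := 'rV[C]_p.
Notation step := (n%:R * eta).
Implicit Types (u : V) (i j : 'I_p).

Lemma latticeN (z : C) : lattice tau z -> lattice tau (- z).
Proof. by move=> [a [b ->]]; exists (- a), (- b); rewrite !intrN; ring. Qed.

Lemma theta_step_neq0 (r : int) : r != 0 -> theta tau (r%:~R * step) != 0.
Proof.
move=> r0; apply/eqP => /(theta_zero_lattice tau_gt0) L.
have [N N0] : exists2 N, (0 < N)%N & lattice tau (N%:R * step).
  case: r r0 L => k k0 L; first by exists k; rewrite // lt0n.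
  exists k.+1 => //; move/latticeN: L.
  by rewrite NegzE intrN mulNr opprK.
by rewrite mulrA -natrM; apply: eta_inf; rewrite muln_gt0 N0.
Qed.

Lemma differentiable_theta_diff i j r u :
  differentiable (fun u => theta_diff n tau eta u i j r) u.
Proof.
exact: (differentiable_comp (differentiable_sub_cst i j (r%:~R * step) u)
  (differentiable_theta tau_gt0 _)).
Qed.

(** Small real translations move a point out of the lattice: the quick form of
    discreteness used for the density of regular points. *)
Lemma real_notin_lattice (e : R) : 0 < e < 1 -> ~ lattice tau e%:C%C.
Proof.
move=> /andP[e0 e1] [a [b]]; case: tau tau_gt0 => x y /= y0 /eqP.
rewrite eq_complex => /andP[/eqP h1 /eqP h2].
have aE (k : int) : k%:~R = (k%:~R : R)%:C%C by rewrite rmorph_int.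
rewrite !aE /= in h1 h2.
have /eqP : (b%:~R : R) * y = 0 by move: h2; rewrite mul0r addr0 add0r => /esym.
rewrite mulf_eq0 (gt_eqF y0) orbF => /eqP b0.
move: h1; rewrite b0 !mul0r subr0 addr0 => ea; rewrite ea in e0 e1.
by move: e0 e1; rewrite -[1]/(1%:~R) ltr0z ltr_int; lia.
Qed.

(** If theta vanished both at a point and at its translate by a small real number
    in the direction i, that number would be in the lattice. For i = j the
    function is a constant, nonzero by the infinite order of eta. *)
Lemma nonzero_dense_theta_diff i j r : (i != j) || (r != 0) ->
  nonzero_dense (fun u => theta_diff n tau eta u i j r).
Proof.
move=> ijr w; have [ij|ij] := eqVneq i j.
  apply: subset_closure; rewrite /= /theta_diff -ij subrr add0r theta_step_neq0//.
  by move: ijr; rewrite -ij eqxx.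
have [th0|th0] := eqVneq (theta_diff n tau eta w i j r) 0; last exact: subset_closure.
move=> B Bw.
have cv : (w + (e : C) *: delta_mx 0 i) @[e --> (0 : C)] --> w.
  have d : differentiable (cst w + (fun e : C => e *: (delta_mx 0 i : V))) (0 : C).
    apply: differentiableD; first exact: differentiable_cst.
    by apply: differentiableZl; apply/derivable1_diffP; exact: derivable_id.
  have w0 : w + (0 : C) *: delta_mx 0 i = w by rewrite scale0r addr0.
  by rewrite -[X in _ --> X]w0; exact: (differentiable_continuous d).
have /nbhs_ballP[e /= e0 He] := cv B Bw.
have [d d0 ed] := ltC_real e0.
(* t < d keeps the translate in B, and t < 1 keeps t out of the lattice. *)
pose t : R := Num.min (d / 2) (1 / 2).
have [t0 t1 td] : [/\ 0 < t, t < 1 & t < d].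
  rewrite /t; split; [rewrite lt_min; apply/andP; split; lra | |].
    by rewrite gt_min; apply/orP; right; lra.
  by rewrite gt_min; apply/orP; left; lra.
exists (w + (t%:C%C : C) *: delta_mx 0 i); split; last first.
  apply: He; rewrite /ball /= sub0r normrN CnormE ed ltcR /= expr0n addr0 sqrtr_sqr.
  by rewrite gtr0_norm.
apply/eqP => th1; apply: (@real_notin_lattice t); first by rewrite t0 t1.
have [a [b L1]] := theta_zero_lattice tau_gt0 th0.
have [a' [b' L2]] := theta_zero_lattice tau_gt0 th1.
exists (a' - a), (b' - b); rewrite !intrB.
have -> : (t%:C%C : C) = ((w + (t%:C%C : C) *: delta_mx 0 i) 0 i -
  (w + (t%:C%C : C) *: delta_mx 0 i) 0 j + r%:~R * step) -
    (w 0 i - w 0 j + r%:~R * step).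
  by rewrite !mxE !eqxx [j == i]eq_sym (negPf ij) /=; ring.
by rewrite L1 L2; ring.
Qed.

(** Regularity in degree d as the nonvanishing of one entire function. The index k
    is shifted by d in order to run over the integers of size at most d. *)
Definition regular_prod d u : C := \prod_i \prod_j
  \prod_(k < (d + d).+1 | (i != j) || (k%:Z - d%:Z != 0)) theta_diff n tau eta u i
    j (k%:Z - d%:Z).

Lemma regular_prodP d u : regular_prod d u != 0 -> regular n tau eta d u.
Proof.
move=> h i j r ijr rd; move: h.
rewrite prodf_seq_neq0 => /allP/(_ i (mem_index_enum _)) /=.
rewrite prodf_seq_neq0 => /allP/(_ j (mem_index_enum _)) /=.
rewrite prodf_seq_neq0 => /allP.
have kd : (absz (r + d%:Z)%R < (d + d).+1)%N by lia.
move=> /(_ (Ordinal kd) (mem_index_enum _)) /=.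
have -> : (absz (r + d%:Z)%R)%:Z - d%:Z = r by lia.
by rewrite ijr.
Qed.

Lemma differentiable_regular_prod d u : differentiable (regular_prod d) u.
Proof.
apply: differentiable_prod => i _; apply: differentiable_prod => j _.
by apply: differentiable_prod => k _; exact: differentiable_theta_diff.
Qed.

Lemma nonzero_dense_regular_prod d : nonzero_dense (regular_prod d).
Proof.
apply: nonzero_dense_prod => i _; split.
  move=> u; apply: differentiable_prod => j _; apply: differentiable_prod => k _.
  exact: differentiable_theta_diff.
apply: nonzero_dense_prod => j _; split.
  by move=> u; apply: differentiable_prod => k _; exact: differentiable_theta_diff.
apply: nonzero_dense_prod => k ijk; split; first by move=> u;
  exact: differentiable_theta_diff.
exact: nonzero_dense_theta_diff.
Qed.

Lemma dense_regular d (P : V -> Prop) : (forall u, regular n tau eta d u -> P u) ->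
  dense ([set u | P u]^°).
Proof.
move=> H; apply: (dense_generic (differentiable_regular_prod d)
  (@nonzero_dense_regular_prod d)).
by move=> v /regular_prodP/H.
Qed.

Lemma differentiable_kernel_den m u : differentiable (kernel_den n tau eta m) u.
Proof.
apply: differentiable_prod => i _; apply: differentiable_prod => j _.
by apply: differentiable_prod => k _; exact: differentiable_theta_diff.
Qed.

Lemma nonzero_dense_kernel_den m : nonzero_dense (kernel_den n tau eta m : V -> C).
Proof.
apply: nonzero_dense_prod => i _; split.
  move=> u; apply: differentiable_prod => j _; apply: differentiable_prod => k _.
  exact: differentiable_theta_diff.
apply: nonzero_dense_prod => j _; split.
  by move=> u; apply: differentiable_prod => k _; exact: differentiable_theta_diff.
apply: nonzero_dense_prod => k ijk; split; first by move=> u;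
  exact: differentiable_theta_diff.
apply: nonzero_dense_theta_diff; have [e|//] := eqVneq i j.
by subst j; have := ltn_ord k; rewrite /=; lia.
Qed.
End Generic.

(** * The homomorphism *)

Section Phi.
Context {R : realType} (n p : nat) (c tau eta : Cplx R).
Hypotheses (n_gt0 : (0 < n)%N) (tau_gt0 : 0 < complex.Im tau).
Hypothesis eta_inf : infinite_order tau eta.
Notation C := (Cplx R).
Notation V := 'rV[C]_p.
Notation M := (mero R p).
Notation B := (Balg eta n p).
Notation multinom := (mpoly.multinom p).
Notation mdeg := mpoly.mdeg.
Notation Qn := (Qn n c tau eta).
Notation shift m := (Bmon_shift eta n m).
Notation "\pi f" := (\pi_M%qT f) (at level 10, f at level 8).
Implicit Types (x y : gfam R) (m : multinom) (u : V).

Definition coef_fun x m : V -> C :=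
  fun u => x (mdeg m) (rowseq (mdeg m) (points n eta m u)) * kernel n tau eta m u.

Definition coef x m : M := germ (coef_fun x m).

Lemma points_nth m u (t : 'I_(mdeg m)) : (points n eta m u)`_t =
  point n eta u (label t).
Proof.
rewrite (nth_map (label t)) ?size_boxes ?ltn_ord//.
by congr point; rewrite [in RHS]/label (tnth_nth (label t)).
Qed.

Lemma meromorphic_coef_fun x m : Qn x -> meromorphic (coef_fun x m).
Proof.
move=> [Fx _]; have [dx _ _ _] := Fx (mdeg m).
have -> : coef_fun x m = fun u =>
    (x (mdeg m) (rowseq (mdeg m) (points n eta m u)) *
      theta tau (- (n%:R * eta)) ^+ mdeg m) /
    kernel_den n tau eta m u.
  by apply/funext => u; rewrite /coef_fun /kernel mulrA.
apply: meromorphic_quotient.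
- move=> u; apply: differentiableM; last exact: differentiable_cst.
  have h : differentiable (fun u => rowseq (mdeg m) (points n eta m u)) u.
    apply: differentiable_row => t; under eq_fun do rewrite points_nth.
    apply: differentiableD; first exact: differentiable_coord.
    exact: differentiable_cst.
  exact: (differentiable_comp h (dx _)).
- by move=> u; exact: differentiable_kernel_den.
- exact: nonzero_dense_kernel_den.
Qed.

Definition coef_mero x m (Qx : Qn x) : merofun p :=
  MeroFun (introT (asboolP _) (meromorphic_coef_fun m Qx)).

Lemma coefE x m (Qx : Qn x) : coef x m = \pi (coef_mero m Qx).
Proof. by rewrite /coef -(germ_merofun (coef_mero m Qx)). Qed.

(** Weaker than a bound on the degrees of x, and thus available for products, whose
    components are controlled at regular points only. *)
Definition bounded_support x : Prop :=
  exists N, forall m, (N <= mdeg m)%N -> coef x m = 0.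

Definition phi x : B :=
  if pselect (bounded_support x) is left e
  then (\sum_(m : mpoly.bmultinom p (projT1 (cid e)))
          coef x (mpoly.bmnm m) *: mpoly.mpolyX M (mpoly.bmnm m) : mpoly.mpoly p M)
  else 0.

Lemma mcoeff_phi x m : bounded_support x -> mpoly.mcoeff m (phi x) = coef x m.
Proof.
move=> bx; rewrite /phi; case: pselect => // e.
case: (cid e) => N /= HN; rewrite raddf_sum /=.
under eq_bigr do rewrite mpoly.mcoeffZ mpoly.mcoeffX.
have [mN|Nm] := ltnP (mdeg m) N; last first.
  rewrite HN// big1// => k _; case: eqP => [e'|_]; last by rewrite mulr0.
  by have := mpoly.bmdeg k; rewrite e' ltnNge Nm.
rewrite (bigD1 (mpoly.BMultinom mN))//= eqxx mulr1 big1 ?addr0// => k km.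
case: eqP => [e'|_]; last by rewrite mulr0.
by case/eqP: km; apply/val_inj.
Qed.

Lemma germ0 (F : V -> C) : (forall u, F u = 0) -> germ F = 0.
Proof.
move=> F0; have -> : F = ((0 : merofun p) : V -> C) by apply/funext.
by rewrite germ_merofun raddf0.
Qed.

Lemma Qn_bounded x : Qn x -> bounded_support x.
Proof.
move=> [_ [N HN]]; exists N => m Nm; apply: germ0 => u.
by rewrite /coef_fun HN// mul0r.
Qed.

Lemma symmetric_Qn x a : Qn x -> symmetric_fun (x a).
Proof. by move=> [Fx _]; case: (Fx a). Qed.

Lemma star_domain_points m u a b (e : mdeg m = (a + b)%N) : regular n tau
  eta (mdeg m) u ->
  star_domain tau (rowseq (a + b) (points n eta m u)).
Proof.
move=> ru.
have : star_domain tau (rowseq (mdeg m) (points n eta m u)).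
  move=> s t st; rewrite !mxE !points_nth point_sub; apply: ru.
    rewrite -negb_and; apply/negP => /andP[/eqP e1 /eqP e2].
    move/negP: st; apply; apply/eqP/label_inj.
    case E1 : (label s) (label t) e1 e2 => [i k] [j l] /= -> kl.
    by congr (_, _); lia.
  have := label_mem s; have := label_mem t.
  have := le_mdeg m (label s).1; have := le_mdeg m (label t).1; lia.
by move: (points n eta m u) => w; move: (mdeg m) e {ru} => d ->.
Qed.

(** Each exponent m' <= m belongs to exactly one degree a of the left factor, and
    star_formula_points gives the terms of that degree. *)
Lemma gmul_coef_fun x y m u : Qn x -> Qn y -> regular n tau eta (mdeg m) u ->
  coef_fun (gmul n tau eta x y) m u =
  \sum_(m' : mpoly.bmultinom p (mdeg m).+1 | [forall i, mpoly.bmnm m' i <= m i]%N)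
    coef_fun x (mpoly.bmnm m') u *
    coef_fun y (mpoly.mnm_sub m (mpoly.bmnm m')) (u + shift (mpoly.bmnm m')).
Proof.
move=> Qx Qy ru; rewrite /coef_fun /gmul mulr_suml.
(* Split the exponents m' <= m by their degree a. *)
pose dg (m' : mpoly.bmultinom p (mdeg m).+1) : 'I_(mdeg m).+1 :=
  Ordinal (mpoly.bmdeg m').
rewrite [RHS](partition_big dg xpredT)//=; apply: eq_bigr => a _.
have ad : (a <= mdeg m)%N := leq_ord a.
have -> : castmx (erefl 1%N, esym (subnKC (leq_ord a)))
  (rowseq (mdeg m) (points n eta m u)) =
  rowseq (a + (mdeg m - a)) (points n eta m u).
  by apply/rowP => t; rewrite castmxE !mxE.
have e : mdeg m = (a + (mdeg m - a))%N by rewrite subnKC.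
have [dx _ _ _] := Qx.1 a; have [dy _ _ _] := Qy.1 (mdeg m - a)%N.
rewrite starE//; last exact: star_domain_points.
rewrite (star_formula_points tau_gt0 e (symmetric_Qn Qx) (symmetric_Qn Qy) ru).
apply: eq_big => [m'|m' /andP[/fintype.forallP m'm /eqP m'a]].
  by congr (_ && _); apply/eqP/eqP => [h|<-//]; apply/val_inj.
have aE a1 a2 s : a1 = a2 -> x a1 (rowseq a1 s) = x a2 (rowseq a2 s) by move=> ->.
have bE a1 a2 s : a1 = a2 -> y a1 (rowseq a1 s) = y a2 (rowseq a2 s) by move=> ->.
congr (_ * _ * (_ * _)); first exact: aE.
by apply: bE; have := mdeg_sub m'm; lia.
Qed.

Lemma gmul_coef x y m : Qn x -> Qn y -> coef (gmul n tau eta x y) m =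
  \sum_(m' : mpoly.bmultinom p (mdeg m).+1 | [forall i, mpoly.bmnm m' i <= m i]%N)
    coef x (mpoly.bmnm m') * mero_shift (shift (mpoly.bmnm m'))
      (coef y (mpoly.mnm_sub m (mpoly.bmnm m'))).
Proof.
move=> Qx Qy; rewrite /coef (@germE _ _ _ (\sum_(m' : mpoly.bmultinom p (mdeg m).+1 |
     [forall i, mpoly.bmnm m' i <= m i]%N)
   (coef_mero (mpoly.bmnm m') Qx *
    merofun_shift (shift (mpoly.bmnm m'))
      (coef_mero (mpoly.mnm_sub m (mpoly.bmnm m')) Qy)))).
  rewrite raddf_sum /=; apply: eq_bigr => m' _.
  by rewrite rmorphM /= -!/(coef _ _) !coefE mero_shift_pi.
apply: (dense_regular n_gt0 tau_gt0 eta_inf (d := mdeg m)) => u ru.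
by rewrite gmul_coef_fun// merofun_sumE.
Qed.

Lemma gmul_bounded x y : Qn x -> Qn y -> bounded_support (gmul n tau eta x y).
Proof.
move=> Qx Qy; have [N1 H1] := Qn_bounded Qx; have [N2 H2] := Qn_bounded Qy.
exists (N1 + N2)%N => m Nm; rewrite gmul_coef// big1// => m' /fintype.forallP m'm.
have [h|h] := leqP N1 (mdeg (mpoly.bmnm m')); first by rewrite H1// mul0r.
rewrite H2 ?raddf0 ?mulr0//; have := mdeg_sub m'm; lia.
Qed.


Lemma glin_coef k x y m : Qn x -> Qn y ->
  coef (glin k x y) m = mero_cst p k * coef x m + coef y m.
Proof.
move=> Qx Qy; rewrite (coefE m Qx) (coefE m Qy) /coef.
have -> : coef_fun (glin k x y) m =
    ((merofun_cst p k * coef_mero m Qx + coef_mero m Qy : merofun p) : V -> C).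
  by apply/funext => u; rewrite /coef_fun /glin mulrDl -mulrA.
by rewrite germ_merofun raddfD /= rmorphM.
Qed.

Lemma glin_bounded k x y : Qn x -> Qn y -> bounded_support (glin k x y).
Proof.
move=> Qx Qy; have [N1 H1] := Qn_bounded Qx; have [N2 H2] := Qn_bounded Qy.
exists (N1 + N2)%N => m Nm; rewrite glin_coef// H1 ?H2 ?mulr0 ?addr0//; lia.
Qed.

Lemma gone_coef m : coef gone m = (m == mpoly.mnm0)%:R.
Proof.
have E d (z : 'rV[C]_d) : gone d z = (d == 0)%:R by case: d z.
have [->|m0] := eqVneq m mpoly.mnm0; last first.
  by apply: germ0 => u; rewrite /coef_fun E mpoly.mdeg_eq0 (negPf m0) mul0r.
rewrite /coef.
have -> : coef_fun gone mpoly.mnm0 = ((1 : merofun p) : V -> C).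
  apply/funext => u; rewrite /coef_fun E mpoly.mdeg_eq0 eqxx mul1r.
  rewrite /kernel /kernel_den big1 ?mpoly.mdeg0 ?divr1// => i _.
  by rewrite big1// => j _; rewrite big1// => -[k]; rewrite mpoly.mnm0E.
by rewrite germ_merofun rmorph1.
Qed.

Lemma gone_bounded : bounded_support gone.
Proof.
exists 1%N => m m1; rewrite gone_coef -mpoly.mdeg_eq0.
by case: (mdeg m) m1.
Qed.

Lemma phi_morphism : Qn_morphism n c tau eta phi.
Proof.
split.
- move=> k x y Qx Qy; apply/mpoly.mpolyP => m.
  rewrite mcoeff_phi; last exact: glin_bounded.
  rewrite glin_coef// [RHS](@mpoly.mcoeffD p M m) (@mpoly.mcoeffZ p M).
  by rewrite !mcoeff_phi//; exact: Qn_bounded.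
- apply/mpoly.mpolyP => m; rewrite mcoeff_phi; last exact: gone_bounded.
  by rewrite gone_coef [RHS](@mpoly.mcoeff1 p M m).
- move=> x y Qx Qy; apply/mpoly.mpolyP => m.
  rewrite mcoeff_phi; last exact: gmul_bounded.
  rewrite gmul_coef// [RHS](@mcoeff_skew_mul M p (fun m => mero_shift (shift m))).
  by apply: eq_bigr => m' _; rewrite !mcoeff_phi//; exact: Qn_bounded.
Qed.

Definition generator_fun (f : C -> C) (a : 'I_p) : V -> C :=
  fun u => f (u 0 a) / \prod_(i < p | i != a) theta tau (u 0 a - u 0 i).

Lemma theta_diff0 i j : (fun u => theta tau (u 0 i - u 0 j)) =
  (fun u => theta_diff n tau eta u i j 0).
Proof. by apply/funext => u; rewrite /theta_diff mul0r addr0. Qed.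

Lemma meromorphic_generator f a : Theta_space n c tau f ->
  meromorphic (generator_fun f a).
Proof.
move=> [df _ _]; apply: meromorphic_quotient.
- move=> u; exact: (differentiable_comp (differentiable_coord u 0 a) (df _)).
- move=> u; apply: differentiable_prod => i _; rewrite theta_diff0.
  exact: differentiable_theta_diff.
- apply: nonzero_dense_prod => i ia; rewrite theta_diff0; split.
    by move=> u; exact: differentiable_theta_diff.
  by apply: nonzero_dense_theta_diff => //; rewrite eq_sym ia.
Qed.

(** For a single box in column a the diagonal factor of the denominator is
    theta (- n eta), which the power of theta in the kernel cancels. *)
Lemma ggen_coef_fun f a : coef_fun (ggen f) (mpoly.mnm1 a) = generator_fun f a.
Proof.
apply/funext => u; rewrite /coef_fun /generator_fun.
have E d (s : seq C) : d = 1%N -> ggen f d (rowseq d s) = f s`_0.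
  by move=> ->; rewrite /= mxE.
have d1 := mpoly.mdeg1 a.
have m0 : (0 < mdeg (mpoly.mnm1 a))%N by rewrite d1.
rewrite E// (points_nth u (Ordinal m0)).
have -> : label (Ordinal m0) = (a, 0%N).
  have := label_mem (Ordinal m0); case: (label _) => i k /=.
  by rewrite mpoly.mnm1E; case: eqP => [<-|//]; rewrite ltnS leqn0 => /eqP ->.
rewrite /point /= mul0r addr0; congr (_ * _).
rewrite /kernel d1 expr1 /kernel_den (bigD1 a)//= [X in _ / (_ * X)]big1
  ?mulr1; last first.
  by move=> i ia; apply: big1 => j _; rewrite mpoly.mnm1E eq_sym (negPf ia) big_ord0.
have -> : \prod_j \prod_(k < mpoly.mnm1 a a) theta_diff n tau eta u a j
  (k%:Z - (mpoly.mnm1 a j)%:Z) =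
    theta tau (- (n%:R * eta)) * \prod_(i < p | i != a) theta tau (u 0 a - u 0 i).
  rewrite (bigD1 a)//=; congr (_ * _).
    by rewrite mpoly.mnm1E eqxx big_ord1 /theta_diff subrr add0r sub0r mulN1r.
  apply: eq_bigr => j ja; rewrite !mpoly.mnm1E eqxx big_ord1 eq_sym (negPf ja).
  by rewrite /theta_diff mul0r addr0.
have t0 : theta tau (- (n%:R * eta)) != 0.
  by rewrite -mulN1r; exact: (theta_step_neq0 n_gt0 tau_gt0 eta_inf (r := -1)).
by rewrite invfM mulrA mulfV// mul1r.
Qed.

Lemma phi_ggen f : Theta_space n c tau f ->
  exists2 m : 'I_p -> mero R p,
    forall a : 'I_p, mero_represented (m a) (generator_fun f a) &
    phi (ggen f) = \sum_(a < p) Bfun eta n (m a) * Bgen eta n a.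
Proof.
move=> tf; pose g a : merofun p := MeroFun
  (introT (asboolP _) (meromorphic_generator a tf)).
exists (fun a => \pi (g a)); first by move=> a; exists (g a).
apply/mpoly.mpolyP => m; rewrite mcoeff_phi; last exact: (Qn_bounded (ggen_Qn eta tf)).
rewrite [RHS](@raddf_sum _ _ (mpoly.mcoeff m)) /=.
under eq_bigr do rewrite Bfun_mul (@mpoly.mcoeffZ p M) (@mpoly.mcoeffX p M).
have [m1|m1] := boolP (mdeg m == 1%N); last first.
  rewrite /coef germ0 => [|u]; last first.
    have E d (z : 'rV[C]_d) : d != 1%N -> ggen f d z = 0 by case: d z => [|[|d]].
    by rewrite /coef_fun E// mul0r.
  rewrite big1// => a _; case: eqP => [e|_]; last by rewrite mulr0.
  by rewrite -e mpoly.mdeg1 in m1.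
have /mpoly.mdeg1P[a /eqP ->] := m1.
rewrite (bigD1 a)//= eqxx mulr1 big1 ?addr0 => [|b ba]; last first.
  by rewrite mpoly.eq_mnm1 (negPf ba) mulr0.
by rewrite /coef ggen_coef_fun -germ_merofun.
Qed.
End Phi.

Theorem proposition6 (R : realType) (n p : nat) (c tau eta : Cplx R)
    (n_gt0 : (0 < n)%N) (p_gt0 : (0 < p)%N)
    (im_tau : 0 < complex.Im tau)
    (eta_inf : infinite_order tau eta) :
  exists phi : gfam R -> Balg eta n p,
    Qn_morphism n c tau eta phi /\
    forall f : Cplx R -> Cplx R, Theta_space n c tau f ->
      exists2 m : 'I_p -> mero R p,
        forall a : 'I_p, mero_represented (m a)
          (fun u => f (u 0 a) / \prod_(i < p | i != a) theta tau (u 0 a - u 0 i)) &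
        phi (ggen f) = \sum_(a < p) Bfun eta n (m a) * Bgen eta n a.
Proof.
exists (@phi R n p tau eta); split; first exact: phi_morphism.
by move=> f; exact: phi_ggen.
Qed.
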